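(* Let $1\le p<\infty$ and $J\in\{\mathbb{N},\mathbb{Z}\}$. There exist a rooted directed tree $V$ and a weighted shift $T$ on $X=\ell^1(V)$ such that $B_T$ is frequently hypercyclic but not chaotic on $\ell^p(X,J)$.
   Context: $\mathbb{N}=\{1,2,\dots\}$. A rooted directed tree (with vertex set $V$) is a countable directed graph with a distinguished vertex (the root) such that every vertex is reached from the root by a unique directed path; every vertex $v$ other than the root has a unique parent $\mathrm{par}(v)$, and $\mathrm{Chi}(v)$ denotes the (possibly infinite) set of children of $v$. $\ell^1(V)$ is the space of absolutely summable scalar families on $V$, with canonical unit vectors $(e_v)_{v\in V}$. Given non-zero scalar weights $(\lambda_v)$, the weighted (backward) shift on $\ell^1(V)$ is the operator $(x_v)_{v\in V}\mapsto\big(\sum_{u\in\mathrm{Chi}(v)}\lambda_u x_u\big)_{v\in V}$, assumed to be a bounded operator on $\ell^1(V)$ (so $e_u\mapsto\lambda_ue_{\mathrm{par}(u)}$ if $u$ is not the root, and $e_{\mathrm{root}}\mapsto 0$). $\ell^p(X,J)$ is the Banach space of families $(x_k)_{k\in J}$ in $X$ with $\sum_k\|x_k\|^p<\infty$ ($\ell^p$-norm), and $B_T(x_k)_{k\in J}=(Tx_{k+1})_{k\in J}$. An operator $S$ on a Banach space $Y$ is chaotic if it is hypercyclic (some $y\in Y$ has dense orbit $\{S^ny:n\ge 0\}$) and its set of periodic points (those $y$ with $S^dy=y$ for some $d\ge1$) is dense in $Y$; it is frequently hypercyclic if there exists $y\in Y$ such that for every non-empty open set $U\subset Y$ the set $\{n\ge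 0:S^ny\in U\}$ has positive lower density, where the lower density of $A\subset\mathbb{N}\cup\{0\}$ is $\liminf_{N\to\infty}\frac{|A\cap[0,N]|}{N+1}$. *)

(* Defs.v *)
From HB Require Import structures.
From mathcomp Require Import all_boot all_order all_algebra finmap.
From mathcomp Require Import ring complex.
From mathcomp Require Import all_classical all_reals all_analysis.
From mathcomp.analysis.showcase Require summability.

Set Implicit Arguments.
Unset Strict Implicit.
Unset Printing Implicit Defensive.

Import Order.TTheory GRing.Theory Num.Theory.
Import numFieldNormedType.Exports.

Local Open Scope classical_set_scope.
Local Open Scope ring_scope.

(* [p1] is unused in the carrier: it is kept as a parameter so that the normed
   space structure, which needs [1 <= p], can be inferred from the type. *)
Definition lp_pred (R : realType) (p : R) (p1 : 1 <= p) (I : choiceType)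
    (E : normedModType R) : {pred I -> E} :=
  [pred x | esum.summable [set: I] (fun i => (`|x i| `^ p)%:E)].

Arguments lp_pred {R p} p1 I E.

Record lp (R : realType) (p : R) (p1 : 1 <= p) (I : choiceType)
    (E : normedModType R) := Lp {
  lp_fun :> I -> E ;
  lp_funP : lp_fun \in lp_pred p1 I E }.

Arguments lp {R p} p1 I E.

Section lp.
Context {R : realType} {p : R} (p1 : 1 <= p) (I : choiceType)
  (E : normedModType R).

Local Notation lp_pred := (lp_pred p1 I E).
Local Notation lp := (lp p1 I E).

Implicit Types (x y : I -> E).

Let p0 : 0 < p. Proof. exact: lt_le_trans p1. Qed.
Let pN0 : p != 0. Proof. by rewrite gt_eqF. Qed.

Local Notation S x := (\esum_(i in [set: I]) (`|x i| `^ p)%:E)%E.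

Let S_ge0 x : (0 <= S x)%E.
Proof. by apply: esum_ge0 => i _; rewrite lee_fin powR_ge0. Qed.

Let lp_predE x : (x \in lp_pred) = (S x < +oo)%E.
Proof.
rewrite inE /= /esum.summable; congr (_ < _)%E.
by apply: eq_esum => i _; rewrite gee0_abs// lee_fin powR_ge0.
Qed.

Let esumZ x (c : R) : 0 <= c ->
  (\esum_(i in [set: I]) (c * `|x i| `^ p)%:E <= c%:E * S x)%E.
Proof.
move=> c0; apply: ge_ereal_sup => _ /= [A [fA _] <-].
under eq_fsbigr do rewrite EFinM.
rewrite -ge0_mule_fsumr//.
apply: lee_wpmul2l; first by rewrite lee_fin.
by apply: ereal_sup_ubound; exists A.
Qed.

Let SZ x (c : R) : (S (fun i => c *: x i) <= (`|c| `^ p)%:E * S x)%E.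
Proof.
apply: le_trans (esumZ _ (powR_ge0 _ _)).
by apply: le_esum => i _; rewrite normrZ powRM.
Qed.

Let hV (c : R) : 0 < c -> c^-1 `^ p = (c `^ p)^-1.
Proof.
move=> c0; apply: (@mulIf _ (c `^ p)); first by rewrite gt_eqF ?powR_gt0.
rewrite mulVf ?gt_eqF ?powR_gt0// -powRM ?invr_ge0 ?(ltW c0)//.
by rewrite mulVf ?gt_eqF// powR1.
Qed.

Let SD_wgt x y (u a b : R) : 0 <= u -> u <= 1 -> 0 < a -> 0 < b ->
  a = (a + b) * u -> b = (a + b) * (1 - u) ->
  (S x <= (a `^ p)%:E)%E -> (S y <= (b `^ p)%:E)%E ->
  (S (fun i => x i + y i) <= ((a + b) `^ p)%:E)%E.
Proof.
move=> u0 u1 a0 b0 ea eb Sx Sy.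
pose s := a + b; have s0 : 0 < s by rewrite addr_gt0.
pose v := 1 - u.
have v0 : 0 <= v by rewrite /v subr_ge0.
pose ca := s `^ p * u * (a `^ p)^-1; pose cb := s `^ p * v * (b `^ p)^-1.
have ca0 : 0 <= ca by rewrite /ca !mulr_ge0 ?invr_ge0 ?powR_ge0.
have cb0 : 0 <= cb by rewrite /cb !mulr_ge0 ?invr_ge0 ?powR_ge0.
have ap0 : 0 < a `^ p by rewrite powR_gt0.
have bp0 : 0 < b `^ p by rewrite powR_gt0.
apply: (@le_trans _ _ (ca%:E * S x + cb%:E * S y)%E); last first.
  apply: (@le_trans _ _ (ca%:E * (a `^ p)%:E + cb%:E * (b `^ p)%:E)%E).
    by apply: leeD; apply: lee_wpmul2l; rewrite ?lee_fin.
  rewrite -!EFinM -EFinD lee_fin /ca /cb !divfK ?gt_eqF//.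
  by rewrite -mulrDr /v addrC subrK mulr1.
apply: le_trans (leeD (esumZ x ca0) (esumZ y cb0)).
rewrite -esumD; [|by move=> i _; rewrite lee_fin mulr_ge0 ?powR_ge0..].
apply: le_esum => i _; rewrite -EFinD lee_fin.
apply: (@le_trans _ _ ((`|x i| + `|y i|) `^ p)).
  by rewrite ge0_ler_powR ?nnegrE ?(ltW p0)// ?addr_ge0// ler_normD.
have -> : `|x i| + `|y i| = s * (u * (`|x i| / a) + v * (`|y i| / b)).
  rewrite mulrDr !mulrA -[s * u]ea -[s * v]eb.
  by rewrite mulrAC divff ?gt_eqF// mul1r mulrAC divff ?gt_eqF// mul1r.
rewrite powRM ?(ltW s0)//; last first.
  by rewrite addr_ge0// mulr_ge0// divr_ge0// ltW.
have -> : ca * `|x i| `^ p + cb * `|y i| `^ p =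
    s `^ p * (u * (`|x i| / a) `^ p + v * (`|y i| / b) `^ p).
  rewrite !powRM ?invr_ge0 ?(ltW a0) ?(ltW b0)// /ca /cb.
  rewrite !hV//.
  by rewrite /v; ring.
rewrite ler_wpM2l ?powR_ge0//.
by apply: (convex_powR p1 (Itv01 u0 u1)) => //=; rewrite inE/= in_itv/= andbT divr_ge0// ltW.
Qed.

Let SD x y (a b : R) : 0 < a -> 0 < b ->
  (S x <= (a `^ p)%:E)%E -> (S y <= (b `^ p)%:E)%E ->
  (S (fun i => x i + y i) <= ((a + b) `^ p)%:E)%E.
Proof.
move=> a0 b0; have s0 : 0 < a + b by rewrite addr_gt0.
have t0 : 0 <= a / (a + b) by rewrite divr_ge0// ltW.
have t1 : a / (a + b) <= 1 by rewrite ler_pdivrMr// mul1r lerDl ltW.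
apply: (SD_wgt t0 t1) => //.
- by rewrite mulrC divfK// gt_eqF.
- by rewrite mulrBr mulr1 mulrC divfK ?gt_eqF// addrC addKr.
Qed.

Let S_bound x : (S x < +oo)%E -> exists2 a : R, 0 < a & (S x <= (a `^ p)%:E)%E.
Proof.
move=> Sx; have Sf : S x \is a fin_num by rewrite ge0_fin_numE.
exists (fine (S x) `^ p^-1 + 1).
  by rewrite ltr_wpDl// powR_ge0.
rewrite -[leLHS](fineK Sf) lee_fin.
rewrite -[leLHS](@powRr1 _ (fine (S x))) ?fine_ge0//.
rewrite -[X in _ `^ X](mulVf pN0) powRrM.
by rewrite ge0_ler_powR ?nnegrE ?(ltW p0)// ?addr_ge0 ?powR_ge0// lerDl.
Qed.

Lemma lp_submod_closed : submod_closed lp_pred.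
Proof.
split.
  rewrite lp_predE esum1// => i _ /=.
  by rewrite normr0 powR0.
move=> c x y; rewrite !lp_predE => Sx Sy.
have Scx : (S (fun i => c *: x i) < +oo)%E.
  apply: le_lt_trans (SZ _ _) _.
  by rewrite lte_mul_pinfty ?lee_fin ?powR_ge0.
have [a a0 Sa] := S_bound Scx; have [b b0 Sb] := S_bound Sy.
exact: le_lt_trans (SD a0 b0 Sa Sb) (ltry _).
Qed.

HB.instance Definition _ :=
  GRing.isSubmodClosed.Build R (I -> E) lp_pred lp_submod_closed.

HB.instance Definition _ := [isSub of lp for @lp_fun R p p1 I E].
HB.instance Definition _ := [Choice of lp by <:].
HB.instance Definition _ := [SubChoice_isSubLmodule of lp by <:].

Definition lp_norm (x : lp) : R :=
  fine (\esum_(i in [set: I]) (`|x i| `^ p)%:E)%E `^ p^-1.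

Let lp_fin (x : lp) : S x \is a fin_num.
Proof. by rewrite ge0_fin_numE// -lp_predE lp_funP. Qed.

Let lp_norm_ge0 (x : lp) : 0 <= lp_norm x. Proof. exact: powR_ge0. Qed.

Let lp_normE (x : lp) : S x = (lp_norm x `^ p)%:E.
Proof.
rewrite /lp_norm -powRrM mulVf// powRr1 ?fineK//.
by rewrite fine_ge0.
Qed.

Let lp_norm_le (x : lp) (a : R) : 0 <= a ->
  (S x <= (a `^ p)%:E)%E -> lp_norm x <= a.
Proof.
move=> a0; rewrite lp_normE lee_fin => h.
move: (lp_norm x) (lp_norm_ge0 x) h => n n0 h.
have : (n `^ p) `^ p^-1 <= (a `^ p) `^ p^-1.
  by rewrite ge0_ler_powR ?nnegrE ?powR_ge0 ?invr_ge0 ?(ltW p0).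
by rewrite -!powRrM mulfV// !powRr1.
Qed.

Lemma ler_lp_normD (x y : lp) : lp_norm (x + y) <= lp_norm x + lp_norm y.
Proof.
apply/ler_addgt0Pr => e e0.
have e2 : 0 < e / 2 by rewrite divr_gt0.
rewrite [e]splitr addrACA; apply: lp_norm_le; first by rewrite !addr_ge0// ltW.
by apply: (@SD x y); rewrite ?ltr_wpDl//; rewrite lp_normE lee_fin;
  rewrite ge0_ler_powR ?nnegrE ?(ltW p0)// ?addr_ge0 ?(ltW e2)// lerDl ltW.
Qed.

Let lp_normZ_le (c : R) (x : lp) : lp_norm (c *: x) <= `|c| * lp_norm x.
Proof.
apply: lp_norm_le; first by rewrite mulr_ge0.
by apply: le_trans (SZ x c) _; rewrite lp_normE -EFinM powRM.
Qed.

Lemma lp_normZ (c : R) (x : lp) : lp_norm (c *: x) = `|c| * lp_norm x.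
Proof.
apply/eqP; rewrite eq_le lp_normZ_le/=.
have [->|c0] := eqVneq c 0; first by rewrite normr0 mul0r.
rewrite -ler_pdivlMl ?normr_gt0// -normfV.
by rewrite -{1}[x](scalerK c0).
Qed.

Lemma lp_norm0_eq0 (x : lp) : lp_norm x = 0 -> x = 0.
Proof.
move=> x0; apply/val_inj/funext => i /=; apply/normr0_eq0.
have : (S x <= 0)%E by rewrite lp_normE x0 powR0.
move=> h; have : ((`|x i| `^ p)%:E <= 0)%E.
  apply: le_trans h; apply: esum_ge; exists [set i] => //.
  by rewrite fsbig_set1.
rewrite lee_fin => h'; apply/eqP.
have /eqP : `|x i| `^ p = 0 by apply/eqP; rewrite eq_le h' powR_ge0.
by rewrite powR_eq0 => /andP[].
Qed.

HB.instance Definition _ :=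
  Lmodule_isNormed.Build R lp ler_lp_normD lp_normZ lp_norm0_eq0.

Lemma lp_normrE (x : lp) :
  `|x| = fine (\esum_(i in [set: I]) (`|x i| `^ p)%:E)%E `^ p^-1.
Proof. by []. Qed.

End lp.

Section Rcomplex_normedModule.
Variable R : realType.

Let Rcomplex_normrZ (l : R) (z : Rcomplex R) : `|l *: z| = `|l| * `|z|.
Proof.
case: z => a b; rewrite /Num.norm /= /Normc.normc /=.
rewrite -/(_ *: _).
by rewrite !exprMn -mulrDr sqrtrM ?sqr_ge0// sqrtr_sqr.
Qed.

HB.instance Definition _ :=
  PseudoMetric.copy (Rcomplex R) (pseudoMetric_normed (Rcomplex R)).
HB.instance Definition _ := isPointed.Build (Rcomplex R) 0.
HB.instance Definition _ :=
  NormedZmod_PseudoMetric_eq.Build R (Rcomplex R) erefl.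
HB.instance Definition _ :=
  PseudoMetricNormedZmod_Lmodule_isNormedModule.Build R (Rcomplex R)
    Rcomplex_normrZ.

End Rcomplex_normedModule.

Variant scalar_kind := RealScalars | ComplexScalars.

(* The complex numbers are taken with their R-valued modulus, as a normed space
   over R; complex scalars enter only through scalar_mul. *)
Definition scalar_field (R : realType) (k : scalar_kind) : normedModType R :=
  match k with RealScalars => R^o | ComplexScalars => Rcomplex R end.

Definition scalar_mul {R : realType} {k : scalar_kind} :
    scalar_field R k -> scalar_field R k -> scalar_field R k :=
  match k with
  | RealScalars => fun a b : R => a * b
  | ComplexScalars => fun a b : R[i] => a * b
  end.

(* Uniqueness is among all directed walks, repeated vertices allowed: this is
   what rules out cycles and edges into the root. *)
Definition rooted_tree (V : countType) (edge : rel V) (root : V) : Prop :=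
  forall v : V, exists! s : seq V, path edge root s /\ last root s = v.

Definition Chi (V : countType) (edge : rel V) (v : V) := {u : V | edge v u}.

Notation l1 := (lp (lexx 1)).

(* The possibly infinite sum over Chi(v) is the limit of the net of its finite
   partial sums. A map satisfying this formula is linear over the scalar field,
   also when the latter is C and l1 V is only given its real structure. *)
Definition weighted_shift (R : realType) (k : scalar_kind) (V : countType)
    (edge : rel V) (lambda : V -> scalar_field R k)
    (T : l1 V (scalar_field R k) -> l1 V (scalar_field R k)) : Prop :=
  forall (x : l1 V (scalar_field R k)) (v : V),
    summability.partial_sum
      (fun u : Chi edge v => scalar_mul (lambda (val u)) (x (val u)))
    @ summability.totally --> T x v.

(* [Naturals] uses nat, starting at 0, for N = {1, 2, ...}: only the successor
   map matters. *)
Variant index_kind := Naturals | Integers.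

Definition index_set (J : index_kind) : choiceType :=
  match J with Naturals => nat | Integers => int end.

Definition index_succ {J : index_kind} : index_set J -> index_set J :=
  match J with Naturals => S | Integers => fun k : int => k + 1 end.

Lemma index_succ_inj (J : index_kind) : injective (@index_succ J).
Proof. by case: J => k l /=; [case|exact: addIr]. Qed.

Section BT.
Context {R : realType} {p : R} (p1 : 1 <= p) (J : index_kind)
  {X : normedModType R} (T : {linear X -> X}) (cT : continuous T).

Lemma BT_subproof (x : lp p1 (index_set J) X) :
  (fun k => T (x (index_succ k))) \in lp_pred p1 (index_set J) X.
Proof.
have p0 : 0 < p by exact: lt_le_trans p1.
have [M [M0 hM]] : exists M : R, 0 <= M /\ forall y, `|T y| <= M * `|y|.
  have /linear_bounded_continuous/linear_boundedP/pinfty_ex_gt0[M M0 h] := cT.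
  by exists M; rewrite ltW.
have := lp_funP x; rewrite !inE /= /esum.summable => Sx.
set a := fun k => `|(`|x k| `^ p)%:E|%E.
apply: (@le_lt_trans _ _ (\esum_(k in [set: index_set J])
    ((M `^ p)%:E * a (index_succ k)))%E).
  apply: le_esum => k _; rewrite /a !gee0_abs ?lee_fin ?powR_ge0//.
  by rewrite -powRM// ge0_ler_powR ?nnegrE ?(ltW p0)// mulr_ge0.
apply: (@le_lt_trans _ _ ((M `^ p)%:E * \esum_(k in [set: index_set J]) a k)%E).
  apply: ge_ereal_sup => _ /= [A [fA _] <-].
  rewrite -ge0_mule_fsumr; last by move=> k; exact: abse_ge0.
  apply: lee_wpmul2l; first by rewrite lee_fin powR_ge0.
  apply: esum_ge; exists (index_succ @` A).
    by split => //; exact: finite_image.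
  by rewrite fsbig_image//; move=> ? ? _ _; exact: index_succ_inj.
by rewrite lte_mul_pinfty ?lee_fin ?powR_ge0.
Qed.

Definition BT (x : lp p1 (index_set J) X) : lp p1 (index_set J) X :=
  Lp (BT_subproof x).

End BT.

Arguments BT {R p} p1 J {X} T cT x.

Definition lower_density (R : realType) (A : set nat) : \bar R :=
  limn_einf (fun N => (#|[pred n : 'I_N.+1 | `[< A n >]]|%:R / N.+1%:R)%:E).

Section dynamics.
Context {R : realType} {Y : normedModType R} (S : Y -> Y).

Definition hypercyclic : Prop :=
  exists y : Y, dense (range (fun n => iter n S y)).

Definition periodic_point (y : Y) : Prop :=
  exists2 d : nat, (1 <= d)%N & iter d S y = y.

Definition chaotic : Prop := hypercyclic /\ dense [set y | periodic_point y].

Definition frequently_hypercyclic : Prop :=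
  exists y : Y, forall U : set Y, open U -> U !=set0 ->
    (0 < lower_density R [set n | U (iter n S y)])%E.

End dynamics.

(* Main.v *)
From HB Require Import structures.
Require Import Defs.
From mathcomp Require Import all_boot all_order all_algebra finmap.
From mathcomp Require Import ring lra zify complex.
From mathcomp Require Import all_classical all_reals all_analysis.
From mathcomp.analysis.showcase Require summability.

(* The vertices are the words over nat, the root is the empty word, and the
   parent of [j :: v] is [v]. A label counts down along an edge of weight 2;
   any other edge out of [v] starts a new countdown and has the tiny weight
   8^-|v|.

   No countdown runs forever, so along a backward orbit of period d all the mass
   keeps being carried by new starts. As the start weights at level m are 8^-m
   while the norms stay below 2^d e, the mass at level d is at most of order
   4^-d e, hence the coordinate at the root of a periodic point is at most e as
   soon as its other coordinates in the index set have norm at most e.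

   On the other hand, for every m, a countdown of length m above v carries e_v
   back in m steps with weight at least 8^-|v| 2^(m-1), uniformly in m. With the
   visit times tau below, which have positive lower density for every target and
   are sufficiently separated, the sum of these preimages of the members of a
   dense sequence is a frequently hypercyclic vector: the preimage chosen for
   the visit at time m is still small at all the earlier visits. *)

Set Implicit Arguments.
Unset Strict Implicit.
Unset Printing Implicit Defensive.

Import Order.TTheory GRing.Theory Num.Theory.
Import numFieldNormedType.Exports.

Local Open Scope classical_set_scope.
Local Open Scope ring_scope.

(** * Coordinates, one-point families and finite truncations in l^p *)

Section lp_theory.
Context {R : realType} {p : R} (p1 : 1 <= p) {I : choiceType}
  {E : normedModType R}.
Implicit Types (x y : lp p1 I E) (f : I -> E) (i : I) (a : R).

Let p0 : 0 < p. Proof. exact: lt_le_trans p1. Qed.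

Lemma lp_ext x y : (forall i, x i = y i) -> x = y.
Proof. by move=> xy; apply/val_inj/funext => i /=; exact: xy. Qed.

Lemma lp0E i : (0 : lp p1 I E) i = 0. Proof. by []. Qed.

Lemma lpDE x y i : (x + y) i = x i + y i. Proof. by []. Qed.

Lemma lpNE x i : (- x) i = - x i. Proof. by []. Qed.

Lemma lpZE (c : R) x i : (c *: x) i = c *: x i. Proof. by []. Qed.

Lemma lp_sumE (T : Type) (s : seq T) (P : pred T) (F : T -> lp p1 I E) i :
  (\sum_(t <- s | P t) F t) i = \sum_(t <- s | P t) F t i.
Proof.
elim: s => [|t s ih]; rewrite ?big_nil// !big_cons.
by case: ifP => // _; rewrite lpDE ih.
Qed.

Lemma lp_esum_ltpinfty x :
  (\esum_(i in [set: I]) (`|x i| `^ p)%:E < +oo)%E.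
Proof.
have := lp_funP x; rewrite inE /= /esum.summable.
by under eq_esum do rewrite gee0_abs ?lee_fin ?powR_ge0//.
Qed.

Lemma lp_memP f : (\esum_(i in [set: I]) (`|f i| `^ p)%:E < +oo)%E ->
  f \in lp_pred p1 I E.
Proof.
rewrite inE /= /esum.summable.
by under [X in _ -> (X < _)%E]eq_esum do rewrite gee0_abs ?lee_fin ?powR_ge0//.
Qed.

Lemma lp_esumE x :
  (\esum_(i in [set: I]) (`|x i| `^ p)%:E = (`|x| `^ p)%:E)%E.
Proof.
have S0 : (0 <= \esum_(i in [set: I]) (`|x i| `^ p)%:E)%E.
  by apply: esum_ge0 => i _; rewrite lee_fin powR_ge0.
rewrite lp_normrE -powRrM mulVf ?gt_eqF// powRr1 ?fine_ge0// fineK//.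
by rewrite ge0_fin_numE// lp_esum_ltpinfty.
Qed.

Lemma lp_norm_le x a : 0 <= a ->
  (\esum_(i in [set: I]) (`|x i| `^ p)%:E <= (a `^ p)%:E)%E -> `|x| <= a.
Proof.
move=> a0; rewrite lp_esumE lee_fin leNgt => h; rewrite leNgt.
by apply: contra h => ax; apply: gt0_ltr_powR; rewrite ?nnegrE.
Qed.

Lemma lp_coord_le x i : `|x i| <= `|x|.
Proof.
suff: `|x i| `^ p <= `|x| `^ p.
  rewrite leNgt => h; rewrite leNgt; apply: contra h => xi.
  by apply: gt0_ltr_powR; rewrite ?nnegrE.
rewrite -lee_fin -lp_esumE; apply: esum_ge; exists [set i] => //.
by rewrite fsbig_set1.
Qed.

Definition single_fun i (v : E) : I -> E := fun j => if j == i then v else 0.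

Lemma esum_single i v :
  (\esum_(j in [set: I]) (`|single_fun i v j| `^ p)%:E = (`|v| `^ p)%:E)%E.
Proof.
rewrite (esumID [set i]) => [|j _]; last by rewrite lee_fin powR_ge0.
rewrite [X in (_ + X)%E]esum1 => [|j]; last first.
  rewrite setTI /single_fun/=; case: eqP => // _ _.
  by rewrite normr0 powR0// gt_eqF.
rewrite setTI adde0 esum_set1/= ?lee_fin ?powR_ge0//.
by rewrite /single_fun eqxx.
Qed.

Lemma single_subproof i v : single_fun i v \in lp_pred p1 I E.
Proof. by apply: lp_memP; rewrite esum_single ltry. Qed.

Definition single i v : lp p1 I E := Lp (single_subproof i v).

Lemma singleE i v j : single i v j = if j == i then v else 0.
Proof. by []. Qed.

Lemma norm_single i v : `|single i v| = `|v|.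
Proof.
rewrite lp_normrE [X in fine X]esum_single /=.
by rewrite -powRrM mulfV ?gt_eqF// powRr1.
Qed.

Lemma single0 i : single i 0 = 0.
Proof. by apply: lp_ext => j; rewrite singleE; case: eqP. Qed.

Lemma singleB i v w : single i (v - w) = single i v - single i w.
Proof.
apply: lp_ext => j; rewrite lpDE lpNE !singleE.
by case: eqP; rewrite ?subr0.
Qed.

Lemma singleD i v w : single i (v + w) = single i v + single i w.
Proof.
apply: lp_ext => j; rewrite lpDE !singleE.
by case: eqP; rewrite ?addr0.
Qed.

Lemma single_sum i (K : Type) (s : seq K) (g : K -> E) :
  single i (\sum_(j <- s) g j) = \sum_(j <- s) single i (g j).
Proof.
by elim: s => [|j s ih]; rewrite ?big_nil ?single0// !big_cons singleD ih.
Qed.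

Definition trunc (A : {fset I}) f : lp p1 I E := \sum_(i <- A) single i (f i).

Lemma truncE A f i : trunc A f i = if i \in A then f i else 0.
Proof.
rewrite lp_sumE; case: ifP => iA.
  rewrite (big_rem i)// singleE eqxx big1_seq => [|j /andP[_ jA]].
    exact: addr0.
  rewrite (singleE j); case: eqP => // ij; move: jA.
  by rewrite -ij mem_rem_uniq ?fset_uniq// inE eqxx.
rewrite big1_seq// => j /andP[_ jA]; rewrite (singleE j).
by case: eqP => // ij; move: iA; rewrite ij jA.
Qed.

Lemma esum_trunc A f :
  (\esum_(i in [set: I]) (`|trunc A f i| `^ p)%:E =
   \sum_(i <- A) (`|f i| `^ p)%:E)%E.
Proof.
rewrite (esumID [set` A]) => [|j _]; last by rewrite lee_fin powR_ge0.
rewrite [X in (_ + X)%E]esum1 => [|j]; last first.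
  rewrite setTI /= truncE => /negP/negbTE ->.
  by rewrite normr0 powR0// gt_eqF.
rewrite setTI adde0.
rewrite (eq_esum (b := fun i => (`|f i| `^ p)%:E)) => [|i]; last first.
  by move=> /= iA; rewrite truncE iA.
rewrite esum_fset => [||i _]; last by rewrite lee_fin powR_ge0.
  by rewrite fsbig_finite ?finite_fset//= set_fsetK.
exact: finite_fset.
Qed.

Lemma norm_trunc_le A x : `|trunc A x| <= `|x|.
Proof.
apply: lp_norm_le => //; rewrite -lp_esumE; apply: le_esum => i _.
rewrite lee_fin truncE; case: ifP => // _.
by rewrite normr0 powR0 ?gt_eqF// powR_ge0.
Qed.

(** Each finite partial sum is the p-th power of the norm of a truncation. As [f] need not be
    summable beforehand, this serves to prove membership in l^p. *)
Lemma esum_le_trunc f a : 0 <= a -> (forall A, `|trunc A f| <= a) ->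
  (\esum_(i in [set: I]) (`|f i| `^ p)%:E <= (a `^ p)%:E)%E.
Proof.
move=> a0 fa; apply: ge_ereal_sup => _ /= [A [fA _] <-].
rewrite fsbig_finite//= -esum_trunc lp_esumE lee_fin.
by apply: ge0_ler_powR; rewrite ?nnegrE// ltW.
Qed.

(** A finite set whose partial sum comes within [(e / 2) ^ p] of the total leaves a tail of norm at
    most [e / 2]. *)
Lemma lp_trunc_dense x e : 0 < e -> exists A, `|x - trunc A x| < e.
Proof.
move=> e0; pose e' := e / 2; have e'0 : 0 < e' by rewrite divr_gt0.
have ep0 : 0 < e' `^ p by rewrite powR_gt0.
pose S := (\esum_(i in [set: I]) (`|x i| `^ p)%:E)%E.
have Sfin : S \is a fin_num by rewrite /S lp_esumE.
have [_ [A [fA _] <-] SA] := ub_ereal_sup_adherent ep0 Sfin.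
exists (fset_set A); apply: (@le_lt_trans _ _ e'); last first.
  by rewrite /e' ltr_pdivrMr// ltr_pMr// ltr1n.
apply: lp_norm_le; first exact: ltW.
have -> : (\esum_(i in [set: I]) (`|(x - trunc (fset_set A) x) i| `^ p)%:E =
    \esum_(i in ~` A) (`|x i| `^ p)%:E)%E.
  rewrite [RHS]esum_mkcond; apply: eq_esum => i _; rewrite lpDE lpNE truncE.
  rewrite in_fset_set// in_setC; case: ifP => /= _; rewrite ?subr0// subrr.
  by rewrite normr0 powR0// gt_eqF.
have := SA; rewrite -/(esum _ _) -/S {1}/S (esumID A); last first.
  by move=> i _; rewrite lee_fin powR_ge0.
rewrite !setTI; have <- : (\esum_(i in A) (`|x i| `^ p)%:E =
    \sum_(i \in A) (`|x i| `^ p)%:E)%E.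
  by rewrite esum_fset// => i _; rewrite lee_fin powR_ge0.
set a := esum A _; set b := esum _ _ => ab.
have afin : a \is a fin_num.
  rewrite ge0_fin_numE; last first.
    by apply: esum_ge0 => i _; rewrite lee_fin powR_ge0.
  apply: le_lt_trans (lp_esum_ltpinfty x).
  by rewrite (esumID A) ?setTI ?leeDl ?esum_ge0//;
    move=> i _; rewrite lee_fin powR_ge0.
move: ab; rewrite lteBlDr// => /ltW.
by rewrite leeD2lE.
Qed.

End lp_theory.

(** * Completeness of l^p *)

Section lp_complete.
Context {R : realType} {p : R} (p1 : 1 <= p) {I : choiceType}
  {E : completeNormedModType R}.

Let p0 : 0 < p. Proof. exact: lt_le_trans p1. Qed.

(** The limit [l] is formed coordinatewise. Its distance to the members of a small set of the filter
    is bounded on every finite set of indices, with a bound independent of that set, and therefore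
    in norm. *)
Lemma lp_complete (F : set_system (lp p1 I E)) :
  ProperFilter F -> cauchy F -> cvg F.
Proof.
move=> FF /cauchy_ballP Fc.
have small e : 0 < e ->
    exists2 A, F A & forall x y, A x -> A y -> `|x - y| < e.
  move=> e0; have [[A B] /= [FA FB] AB] := Fc e e0.
  exists (A `&` B); first exact: filterI.
  move=> x y [Ax _] [_ By]; have := AB (x, y) (conj Ax By).
  by rewrite -ball_normE.
have cvgi i : cvg ((fun x : lp p1 I E => x i) @ F).
  apply: cauchy_cvg; apply/cauchy_ballP => e /small[A FA Ae].
  exists (@^~ i @` A, @^~ i @` A).
    by split; apply: (@filterS _ F _ A) => // x Ax; exists x.
  move=> [_ _] [/= [x Ax <-] [y Ay <-]]; rewrite -ball_normE/=.
  by apply: le_lt_trans (Ae _ _ Ax Ay); rewrite -lpNE -lpDE lp_coord_le.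
pose l i := lim ((fun x : lp p1 I E => x i) @ F).
(* On a finite set of indices, coordinatewise convergence is uniform. *)
have near_l (A : {fset I}) d : 0 < d ->
    F [set y | `|trunc p1 A l - trunc p1 A y| <= #|`A|%:R * d].
  move=> d0; have : F [set y | forall i : A, `|l (val i) - y (val i)| < d].
    by apply: filter_forall => i; have /cvgrPdist_lt := cvgi (val i); exact.
  apply: filterS => y yA /=; rewrite /trunc -sumrB.
  apply: le_trans (ler_norm_sum _ _ _) _.
  have -> : #|`A|%:R * d = \sum_(i <- A) d.
    by rewrite big_const_seq count_predT iter_addr_0 mulr_natl.
  rewrite big_seq [leRHS]big_seq; apply: ler_sum => i iA.
  by rewrite -singleB norm_single ltW// (yA [` iA]%fset).
have truncl e A x : 0 < e -> F A ->
    (forall x y, A x -> A y -> `|x - y| < e) -> A x ->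
    forall B, `|trunc p1 B (fun i => l i - x i)| <= e.
  move=> e0 FA Ae Ax B; apply/ler_addgt0Pr => d d0.
  (* The added 1 covers the empty [B]; multiplied by the cardinality of [B], the error stays at most
     [d]. *)
  have c0 : 0 < d / (#|`B|%:R + 1).
    by rewrite divr_gt0// ltr_wpDl.
  have [y [yB Ay]] := filter_ex (filterI (near_l B _ c0) FA).
  have -> : trunc p1 B (fun i => l i - x i) =
      trunc p1 B (y - x) + (trunc p1 B l - trunc p1 B y).
    apply: lp_ext => i; rewrite lpDE lpDE lpNE !truncE; case: ifP => _.
      by rewrite lpDE lpNE [RHS]addrC addrA subrK.
    by rewrite subrr addr0.
  apply: le_trans (ler_normD _ _) _; apply: lerD.
    by apply: le_trans (norm_trunc_le _ _) _; exact: ltW (Ae _ _ _ _).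
  apply: le_trans yB _; rewrite mulrCA ger_pMr// ler_pdivrMr ?ltr_wpDl//.
  by rewrite mul1r lerDl.
have sub_mem e A x : 0 < e -> F A ->
    (forall x y, A x -> A y -> `|x - y| < e) -> A x ->
    (\esum_(i in [set: I]) (`|l i - x i| `^ p)%:E <= (e `^ p)%:E)%E.
  move=> e0 FA Ae Ax.
  apply: (@esum_le_trunc _ _ p1 _ _ (fun i => l i - x i)); first exact: ltW.
  exact: truncl FA Ae Ax.
have lmem : l \in lp_pred p1 I E.
  have [A FA A1] := small 1 ltr01; have [x Ax] := filter_ex FA.
  have lx : (fun i => l i - x i) \in lp_pred p1 I E.
    apply: lp_memP.
    exact: le_lt_trans (sub_mem 1 A x ltr01 FA A1 Ax) (ltry _).
  suff -> : l = (Lp lx + x : lp p1 I E) by exact: lp_funP.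
  by apply/funext => i; rewrite lpDE/= subrK.
apply/cvg_ex; exists (Lp lmem); apply/cvgrPdist_le => e e0.
have [A FA Ae] := small e e0; apply: (@filterS _ F _ A) => // x Ax /=.
apply: lp_norm_le; [exact: ltW|exact: (sub_mem e A x e0 FA Ae Ax)].
Qed.

HB.instance Definition _ := Uniform_isComplete.Build (lp p1 I E) lp_complete.

End lp_complete.

(* Unordered sums of absolutely summable families *)
#[local] Existing Instance summability.totally_filter.

Lemma esum_mule_le {R : realType} {I : choiceType} (A : set I) (c : R)
    (a : I -> \bar R) : 0 <= c -> (forall i, 0 <= a i)%E ->
  (\esum_(i in A) (c%:E * a i) <= c%:E * \esum_(i in A) a i)%E.
Proof.
move=> c0 a0; apply: ge_ereal_sup => _ /= [B [fB BA] <-].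
rewrite -ge0_mule_fsumr//; apply: lee_wpmul2l; first by rewrite lee_fin.
by apply: esum_ge; exists B.
Qed.

Section l1_sum.
Context {R : realType} {I : choiceType} {E : completeNormedModType R}.
Implicit Types x y : l1 I E.

Lemma l1_esumE x : (\esum_(i in [set: I]) `|x i|%:E = `|x|%:E)%E.
Proof.
rewrite -[ `|x| ]powRr1// -lp_esumE.
by apply: eq_esum => i _; rewrite powRr1.
Qed.

Lemma l1_memP (f : I -> E) : (\esum_(i in [set: I]) `|f i|%:E < +oo)%E ->
  f \in lp_pred (lexx 1) I E.
Proof.
move=> h; apply: lp_memP; apply: le_lt_trans h.
by apply: le_esum => i _; rewrite powRr1.
Qed.

Lemma l1_finsum_le (A : {fset I}) x : \sum_(i <- A) `|x i| <= `|x|.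
Proof.
rewrite -lee_fin -l1_esumE -sumEFin; apply: esum_ge.
exists [set` A]; first by split => //; exact: finite_fset.
by rewrite fsbig_finite ?finite_fset//= set_fsetK.
Qed.

Lemma partial_sumE (f : I -> E) (A : {fset I}) :
  summability.partial_sum f A = \sum_(i <- A) f i.
Proof. by rewrite /summability.partial_sum big_seq_fsetE. Qed.

(** The net is Cauchy: if the truncation to [A] is within [e] of [x], then all partial sums over
    sets containing [A] are within [e] of the one over [A]. *)
Lemma l1_cvg x : cvg (summability.partial_sum x @ summability.totally).
Proof.
apply: cauchy_cvg; apply: cauchy_exP => e e0.
have [A xA] := lp_trunc_dense x e0.
exists (summability.partial_sum x A); exists A => //= B /= AB.
rewrite -ball_normE/= !partial_sumE distrC.
have -> : \sum_(i <- B) x i - \sum_(i <- A) x i =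
    \sum_(i <- B) (x - trunc _ A x) i.
  rewrite [RHS](eq_bigr (fun i => x i - trunc (lexx 1) A x i))//.
  rewrite sumrB; congr (_ - _).
  rewrite [RHS](eq_bigr (fun i => if i \in A then x i else 0)); last first.
    by move=> i _; rewrite truncE.
  rewrite -big_mkcond/= -[RHS]big_filter; apply: perm_big; apply: uniq_perm.
  - exact: fset_uniq.
  - by rewrite filter_uniq// fset_uniq.
  - move=> i; rewrite mem_filter; case: (boolP (i \in A)) => //= iA.
    by rewrite (fsubsetP AB).
apply: le_lt_trans xA; apply: le_trans (l1_finsum_le B _).
exact: ler_norm_sum.
Qed.

Lemma l1_sum_cvg x :
  summability.partial_sum x @ summability.totally --> summability.sum x.
Proof. exact: l1_cvg. Qed.

Lemma norm_l1_sum_le x : `|summability.sum x| <= `|x|.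
Proof.
have h : `|summability.partial_sum x A| @[A --> summability.totally] -->
    `|summability.sum x| by apply: cvg_norm; exact: l1_sum_cvg.
apply: (cvgr_to_le h).
exists fset0 => //= A _; rewrite partial_sumE.
by apply: le_trans (l1_finsum_le A x); exact: ler_norm_sum.
Qed.

Lemma l1_sum_linear (c : R) x y :
  summability.sum (c *: x + y) = c *: summability.sum x + summability.sum y.
Proof.
apply: cvg_lim => //.
have -> : summability.partial_sum (c *: x + y) =
    (fun A => c *: summability.partial_sum x A + summability.partial_sum y A).
  apply/funext => A; rewrite !partial_sumE scaler_sumr -big_split.
  exact: eq_bigr.
by apply: cvgD; [apply: cvgZr|]; exact: l1_sum_cvg.
Qed.

Lemma l1_sum0 : summability.sum (fun i : I => 0 : E) = 0.
Proof.
apply/eqP; rewrite -normr_le0.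
by rewrite (le_trans (norm_l1_sum_le 0))// normr0.
Qed.

Lemma l1_sum_single (i : I) (a : E) : summability.sum (single_fun i a) = a.
Proof.
apply: cvg_lim => //; apply: cvg_near_cst; exists [fset i]%fset => //= A iA.
rewrite partial_sumE (big_fsetD1 i)/=; last by rewrite (fsubsetP iA)// inE.
rewrite /single_fun eqxx big1_seq ?addr0// => j /andP[_].
by rewrite !inE => /andP[/negbTE ->].
Qed.

End l1_sum.

(** * Bounded weighted shifts along an edge relation with unique parents *)

Section tree_shift_theory.
Context {R : realType} {V : countType} (edge : rel V).
Context (edge_inj : forall v v' u, edge v u -> edge v' u -> v = v').
Context (w : V -> R) (w0 : forall v, 0 <= w v).
Context (M : R) (M0 : 0 <= M) (wM : forall v, w v <= M).
Context {E : completeNormedModType R}.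
Implicit Types (x y : l1 V E) (v u : V).

Definition chi_fun x v : Chi edge v -> E :=
  fun u : Chi edge v => w (val u) *: x (val u).

Lemma esum_chi x v :
  (\esum_(u in [set: Chi edge v]) `|chi_fun x u|%:E =
   \esum_(u in [set u | edge v u]) (w u * `|x u|)%:E)%E.
Proof.
rewrite (reindex_esum [set: Chi edge v] _ val).
  by apply: eq_esum => u _; rewrite normrZ ger0_norm.
split => [[u vu]//=||]; first by move=> ? ? _ _; exact: val_inj.
by move=> u /= vu; exists (exist _ u vu).
Qed.

Lemma esum_wM x (A : set V) :
  (\esum_(u in A) (w u * `|x u|)%:E <= (M * `|x|)%:E)%E.
Proof.
apply: (@le_trans _ _ (\esum_(u in [set: V]) (M%:E * `|x u|%:E))%E).
  rewrite esum_mkcond; apply: le_esum => u _; case: ifP => _; last first.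
    by rewrite -EFinM lee_fin mulr_ge0.
  by rewrite lee_fin ler_wpM2r.
rewrite EFinM -l1_esumE; apply: esum_mule_le => // u.
Qed.

Lemma chi_subproof x v : chi_fun x (v := v) \in lp_pred (lexx 1) (Chi edge v) E.
Proof.
by apply: l1_memP; rewrite esum_chi (le_lt_trans (esum_wM x _))// ltry.
Qed.

Definition chi_l1 x v : l1 (Chi edge v) E := Lp (chi_subproof x v).

Definition tree_shift_fun x v : E := summability.sum (chi_l1 x v).

(** Since parents are unique, the sets of children are disjoint, and the double sum over [A] and
    over children becomes one sum over the vertices whose parent is in [A]. *)
Lemma esum_tree_shift_fun x (A : set V) :
  (\esum_(v in A) `|tree_shift_fun x v|%:E <=
   \esum_(u in [set u | exists2 v, A v & edge v u]) (w u * `|x u|)%:E)%E.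
Proof.
apply: (@le_trans _ _ (\esum_(v in A) \esum_(u in [set u | edge v u])
    (w u * `|x u|)%:E)%E).
  apply: le_esum => v _; rewrite -esum_chi.
  by rewrite (l1_esumE (chi_l1 x v)) lee_fin norm_l1_sum_le.
rewrite esum_esum; last by move=> v u _ _; rewrite lee_fin mulr_ge0.
rewrite (reindex_esum (A `*`` (fun v => [set u | edge v u])) _ snd)//.
split => /=; first by move=> [v u]/= [Av vu]; exists v.
  move=> [v u] [v' u'] /[!inE]/= -[_ vu] [_ vu'] uu'; rewrite uu' in vu *.
  by rewrite (edge_inj vu vu').
by move=> u [v Av vu]; exists (v, u).
Qed.

Lemma tree_shift_subproof x : tree_shift_fun x \in lp_pred (lexx 1) V E.
Proof.
apply: l1_memP; apply: le_lt_trans (esum_tree_shift_fun x _) _.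
by rewrite (le_lt_trans (esum_wM x _))// ltry.
Qed.

Definition tree_shift x : l1 V E := Lp (tree_shift_subproof x).

Lemma tree_shiftE x v : tree_shift x v = summability.sum (chi_l1 x v).
Proof. by []. Qed.

Lemma esum_tree_shift x (A : set V) :
  (\esum_(v in A) `|tree_shift x v|%:E <=
   \esum_(u in [set u | exists2 v, A v & edge v u]) (w u * `|x u|)%:E)%E.
Proof. exact: esum_tree_shift_fun. Qed.

Lemma norm_tree_shift x : `|tree_shift x| <= M * `|x|.
Proof.
by rewrite -lee_fin -l1_esumE (le_trans (esum_tree_shift _ _))// esum_wM.
Qed.

Lemma tree_shift_linear : linear tree_shift.
Proof.
move=> c x y; apply: lp_ext => v; rewrite lpDE lpZE !tree_shiftE -l1_sum_linear.
congr (summability.sum _); apply/funext => u; rewrite lpDE lpZE/= /chi_fun.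
by rewrite lpDE lpZE scalerDr !scalerA mulrC.
Qed.

HB.instance Definition _ := GRing.isLinear.Build R (l1 V E) (l1 V E) _
  tree_shift tree_shift_linear.

Lemma tree_shift_continuous : continuous tree_shift.
Proof.
apply/linear_bounded_continuous/linear_boundedP.
exists M; split; first exact: num_real.
move=> r Mr x; apply: le_trans (norm_tree_shift x) _.
by rewrite ler_wpM2r// ltW.
Qed.

Lemma tree_shift_single_root u a : (forall v, ~~ edge v u) ->
  tree_shift (single _ u a) = 0.
Proof.
move=> uroot; apply: lp_ext => v; rewrite tree_shiftE lp0E.
rewrite (_ : chi_l1 _ _ = 0); last first.
  apply: lp_ext => -[u' vu'] /=; rewrite /chi_fun singleE /=.
  by case: eqP => [u'u|_]; [move: (uroot v); rewrite -u'u vu'|rewrite scaler0].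
exact: l1_sum0.
Qed.

Lemma tree_shift_single v u a : edge v u ->
  tree_shift (single (lexx 1) u a) = single (lexx 1) v (w u *: a).
Proof.
move=> vu; apply: lp_ext => v'; rewrite tree_shiftE singleE.
case: eqP => [v'v|v'v].
  rewrite v'v -[RHS](l1_sum_single (exist _ u vu : Chi edge v)).
  congr (summability.sum _); apply/funext => u' /=; rewrite /chi_fun singleE.
  rewrite /single_fun -val_eqE/=; case: eqP => [->//|_].
  by rewrite scaler0.
rewrite (_ : chi_l1 _ _ = 0) ?l1_sum0//.
apply: lp_ext => -[u' vu'] /=; rewrite /chi_fun singleE /=.
case: eqP => [u'u|_]; last by rewrite scaler0.
by case: v'v; apply: edge_inj vu; rewrite -u'u.
Qed.

End tree_shift_theory.

(** * Iterates of [BT] and of the index successor *)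

Section iterate_BT.
Context {R : realType} {p : R} (p1 : 1 <= p) (J : index_kind)
  {X : normedModType R} (T : {linear X -> X}) (cT : continuous T).
Local Notation B := (BT p1 J _ cT).

Lemma iter_BTE n x k : iter n B x k = iter n T (x (iter n index_succ k)).
Proof.
by elim: n k => //= n ih k; rewrite ih -iterSr -iterS.
Qed.

End iterate_BT.

Lemma iter_index_succ_neq (J : index_kind) n (k : index_set J) :
  iter n.+1 index_succ k <> k.
Proof.
case: J k => k.
  suff -> : iter n.+1 (@index_succ Naturals) k = (n.+1 + k)%N.
    by move=> /eqP; rewrite -[X in _ == X]add0n eqn_add2r.
  by elim: n => //= n ->.
suff -> : iter n.+1 (@index_succ Integers) k = k + n.+1%:Z.
  by move=> /eqP; rewrite -[X in _ == X]addr0 (inj_eq (addrI _)).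
by elim: n => //= n ->; rewrite -addrA -PoszD addn1.
Qed.

(** * The tree of words over [nat] and its weights *)

Definition seq_edge : rel (seq nat) :=
  fun v u => (u != [::]) && (behead u == v).

Lemma seq_edge_inj v v' u : seq_edge v u -> seq_edge v' u -> v = v'.
Proof. by move=> /andP[_ /eqP <-] /andP[_ /eqP]. Qed.

Lemma seq_edge_cons j v : seq_edge v (j :: v).
Proof. by rewrite /seq_edge/=. Qed.

(** Induction on the word: the last edge of a walk ending in [j :: v] can only come from [v], and no
    edge enters the empty word. *)
Lemma seq_rooted_tree : rooted_tree seq_edge [::].
Proof.
elim=> [|j v [s [[ps ls] us]]].
  exists [::]; split=> // s [ps ls].
  case/lastP: s ps ls => // s x; rewrite rcons_path last_rcons.
  by move=> /andP[_ /andP[/eqP]].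
exists (rcons s (j :: v)); split.
  by rewrite rcons_path last_rcons ps ls seq_edge_cons.
move=> t [pt lt]; case/lastP: t pt lt => // t x.
rewrite rcons_path last_rcons => /andP[pt tx] xE; rewrite xE in tx *.
by congr rcons; apply: us; split=> //; case/andP: tx => _ /eqP.
Qed.

(* The label of a vertex counts down along an edge of weight [2]; every other
   edge starts a new countdown. *)
Definition wt (R : realType) (u : seq nat) : R :=
  if u is j :: v then
    if ohead v == Some j.+1 then 2 else 8^-1 ^+ size v
  else 1.

(** * Mass estimates by level for the countdown shift, and absence of chaos *)

Section countdown_shift.
Context {R : realType}.

Lemma wt_gt0 u : 0 < wt R u.
Proof.
by case: u => //= j v; case: ifP => // _; rewrite exprn_gt0// invr_gt0.
Qed.

Lemma wt_ge0 u : 0 <= wt R u. Proof. exact/ltW/wt_gt0. Qed.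

Lemma wt_le2 u : wt R u <= 2.
Proof.
case: u => [|j v] /=; first by rewrite ler1n.
case: ifP => // _; apply: (@le_trans _ _ 1); last by rewrite ler1n.
by rewrite exprn_ile1// invf_le1// ler1n.
Qed.

Context {E : completeNormedModType R}.

Definition cshift : l1 (seq nat) E -> l1 (seq nat) E :=
  tree_shift seq_edge_inj wt_ge0 (ler0n _ 2) wt_le2.
HB.instance Definition _ := GRing.Linear.on cshift.

Implicit Types (x z : l1 (seq nat) E) (m H : nat) (u v : seq nat).

Lemma norm_cshift x : `|cshift x| <= 2 * `|x|.
Proof. exact: norm_tree_shift. Qed.

Lemma norm_iter_cshift n x : `|iter n cshift x| <= 2 ^+ n * `|x|.
Proof.
elim: n => [|n ih]; first by rewrite mul1r.
rewrite iterS exprS -mulrA; apply: le_trans (norm_cshift _) _.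
by apply: ler_wpM2l ih; rewrite ler0n.
Qed.

Definition level m : set (seq nat) := [set u | size u = m].

Definition level_below m H : set (seq nat) :=
  [set u | size u = m /\ (head 0 u < H)%N].

Lemma esum_cshift_level m x :
  (\esum_(u in level m) `|cshift x u|%:E <=
   2%:E * \esum_(u in level m.+1) `|x u|%:E)%E.
Proof.
apply: le_trans (esum_tree_shift _ _ _ _ _ _) _.
apply: le_trans (esum_mule_le _ _ _) => //.
rewrite (_ : [set u | _] = level m.+1).
  by apply: le_esum => u _; rewrite -EFinM lee_fin ler_wpM2r// wt_le2.
apply/seteqP; split=> [u [v vm /andP[u0 /eqP uv]]|[//|j v] [vm]].
  by case: u u0 uv => // j u _ /= uv; rewrite /level/= uv vm.
by exists v => //; exact: seq_edge_cons.
Qed.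

Lemma esum_iter_cshift_level n x :
  (\esum_(u in level 0) `|iter n cshift x u|%:E <=
   (2 ^+ n)%:E * \esum_(u in level n) `|x u|%:E)%E.
Proof.
suff h m : (\esum_(u in level m) `|iter n cshift x u|%:E <=
   (2 ^+ n)%:E * \esum_(u in level (n + m)) `|x u|%:E)%E.
  by have := h 0; rewrite addn0.
elim: n m => [|n ih] m; first by rewrite mul1e.
apply: le_trans (esum_cshift_level _ _) _; rewrite exprS EFinM -muleA.
by apply: lee_wpmul2l => //; rewrite addSnnS; exact: ih.
Qed.

(** A child along a countdown edge has a label one less than its parent, so it lies below [H], and
    its weight is 2. Any other child of a vertex on level [m] has weight [8^-1 ^+ m], and all these
    children together carry at most the norm of [x]. *)
Lemma esum_cshift_level_below m H x : (0 < m)%N ->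
  (\esum_(u in level_below m H.+1) `|cshift x u|%:E <=
   2%:E * (\esum_(u in level_below m.+1 H) `|x u|%:E)
   + (8^-1 ^+ m * `|x|)%:E)%E.
Proof.
move=> m0; apply: le_trans (esum_tree_shift _ _ _ _ _ _) _.
set S := [set u | _].
apply: (@le_trans _ _ (\esum_(u in S)
   ((if u \in level_below m.+1 H then 2%:E * `|x u|%:E else 0) +
    (8^-1 ^+ m)%:E * `|x u|%:E))%E).
  apply: le_esum => u [v [vm vH] /andP[u0 /eqP uv]].
  case: u u0 uv => // j u _ /= uv; subst u.
  case: ifP => jH; last first.
    rewrite vm; case: ifP => uS; rewrite -?EFinM -?EFinD lee_fin ?add0r//.
    by rewrite lerDr mulr_ge0.
  rewrite ifT ?leeDl// ?lee_fin ?mulr_ge0// ?exprn_ge0// inE.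
  split => /=; first by rewrite vm.
  by case: v vm vH jH => [|i v]//= _ iH /eqP[<-]; rewrite -ltnS.
rewrite esumD; last 2 first.
- by move=> u _; case: ifP => // _; rewrite -EFinM lee_fin mulr_ge0.
- by move=> u _; rewrite -EFinM lee_fin mulr_ge0// exprn_ge0// invr_ge0.
apply: leeD.
  apply: (le_trans _ (esum_mule_le _ _ _)) => //.
  rewrite esum_mkcond [leRHS]esum_mkcond; apply: le_esum => u _.
  by case: ifP => _; case: ifP => _ //; rewrite -EFinM lee_fin mulr_ge0.
rewrite EFinM -l1_esumE; apply: (le_trans _ (esum_mule_le _ _ _)) => //.
  rewrite esum_mkcond; apply: le_esum => u _.
  by case: ifP => _ //; rewrite -EFinM lee_fin mulr_ge0// exprn_ge0// invr_ge0.
Qed.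

(* Along a backward orbit the countdowns run out, so that all the mass on level
   [m] has to enter through edges that start a countdown at a level [>= m]. *)
Lemma backward_orbit_level (P : nat -> set (l1 (seq nat) E)) (K : R) :
  (forall m z, (0 < m)%N -> P m z ->
     `|z| <= K /\ exists2 z', P m.+1 z' & z = cshift z') ->
  forall m z, (0 < m)%N -> P m z ->
    (\esum_(u in level m) `|z u|%:E <= (2 * K * 8^-1 ^+ m)%:E)%E.
Proof.
move=> PK m z m0 Pz.
have K0 : 0 <= K by have [zK _] := PK m z m0 Pz; apply: le_trans zK.
(* Induction on the bound for the labels, with the level free: one step back along the orbit lowers
   [H] and raises [m]. *)
have below H : (\esum_(u in level_below m H) `|z u|%:E <=
    (2 * K * 8^-1 ^+ m)%:E)%E.
  elim: H m z m0 Pz => [|H ih] m z m0 Pz.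
    rewrite esum1 => [|u [_]]; last by rewrite ltn0.
    by rewrite lee_fin !mulr_ge0// exprn_ge0// invr_ge0.
  have [_ [z' Pz' ->]] := PK m z m0 Pz.
  apply: le_trans (esum_cshift_level_below _ _ _) _ => //.
  have [z'K _] := PK m.+1 z' isT Pz'.
  apply: (@le_trans _ _ (2%:E * (2 * K * 8^-1 ^+ m.+1)%:E
      + (8^-1 ^+ m * K)%:E)%E).
    apply: leeD; first by apply: lee_wpmul2l => //; exact: ih.
    by rewrite lee_fin ler_wpM2l// exprn_ge0// invr_ge0.
  rewrite -EFinM -EFinD lee_fin exprS.
  have a0 : 0 <= K * 8^-1 ^+ m by rewrite mulr_ge0// exprn_ge0// invr_ge0.
  (* The constant 2 reproduces itself: the older mass contributes [4 / 8] and the new starts 1, in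
     total less than 2. *)
  have -> : 2 * (2 * K * (8^-1 * 8^-1 ^+ m)) + 8^-1 ^+ m * K =
     (K * 8^-1 ^+ m) * (4 / 8 + 1) by ring.
  rewrite [leRHS](_ : _ = (K * 8^-1 ^+ m) * 2); last by ring.
  by apply: ler_wpM2l => //; lra.
apply: ge_ereal_sup => _ /= [A [fA Am] <-].
(* A finite set has bounded labels; this sum exceeds each of them. *)
pose H := (\sum_(u <- fset_set A) (head 0 u).+1)%N.
apply: le_trans (below H); apply: esum_ge; exists A => //.
split=> // u Au; split; first exact: Am.
rewrite /H (big_rem u) ?in_fset_set ?inE//=.
by rewrite leq_addr.
Qed.

Context {p : R} (p1 : 1 <= p) (J : index_kind) (cT : continuous cshift).

Lemma periodic_bound (e : R) (x : lp p1 (index_set J) (l1 (seq nat) E))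
    (k : index_set J) :
  periodic_point (BT p1 J _ cT) x ->
  (forall i, i <> k -> `|x i| <= e) -> `|x k [::]| <= e.
Proof.
move=> [d d0 xd] xe.
have e0 : 0 <= e.
  by apply: le_trans (xe _ (@iter_index_succ_neq J 0 k)).
pose s n := iter n index_succ k.
have xT n : iter d cshift (x (s (n + d)%N)) = x (s n).
  by rewrite -[in RHS]xd iter_BTE /s addnC iterD.
(* Between the coordinates of [x] at multiples of [d] the backward orbit is filled in by iterates of
   the shift. For [m > 0] only coordinates other than [k] occur, so the norms are at most
   [2 ^+ d * e]. *)
pose P m := [set z | exists i, [/\ (i < d)%N, (d %| m + i)%N &
  z = iter i cshift (x (s (m + i)%N))]].
have /(_ d (x (s d)) d0) : forall m z, (0 < m)%N -> P m z ->
    (\esum_(u in level m) `|z u|%:E <= (2 * (2 ^+ d * e) * 8^-1 ^+ m)%:E)%E.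
  apply: backward_orbit_level => m z m0 [i [id dmi zE]]; split.
    rewrite zE (le_trans (norm_iter_cshift _ _))//; apply: ler_pM => //.
      by rewrite ler_weXn2l ?ler1n// ltnW.
    apply: xe; rewrite /s; case: m m0 {zE dmi} => // m _.
    exact: iter_index_succ_neq.
  case: i id dmi zE => [|i] id dmi zE.
    rewrite zE addn0 /=; exists (iter d.-1 cshift (x (s (m + d)%N))).
      exists d.-1; rewrite addSnnS prednK//; split=> //.
      by rewrite dvdn_addl// -[m]addn0.
    by rewrite -iterS prednK// xT.
  exists (iter i cshift (x (s (m + i.+1)%N))); last by rewrite zE.
  by exists i; rewrite addSnnS; split=> //; exact: ltnW.
have Pd : P d (x (s d)) by exists 0; rewrite addn0; split.
move=> /(_ Pd) h.
rewrite -lee_fin; apply: (@le_trans _ _ (\esum_(u in level 0) `|x k u|%:E)%E).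
  apply: esum_ge; exists [set [::]]; last by rewrite fsbig_set1.
  by split => // u ->.
rewrite -[x k]/(x (s 0)) -xT.
apply: le_trans (esum_iter_cshift_level _ _) _; rewrite add0n.
apply: (@le_trans _ _ ((2 ^+ d)%:E * (2 * (2 ^+ d * e) * 8^-1 ^+ d)%:E)%E).
  by apply: lee_wpmul2l.
rewrite -EFinM lee_fin.
(* The start weights gain [8^-d], while the norm bound and the [d] shifts down to the root lose only
   [4^d]; what remains is at most [e] because [d >= 1]. *)
have -> : 2 ^+ d * (2 * (2 ^+ d * e) * 8^-1 ^+ d) = 2 * (2^-1 ^+ d) * e.
  have -> : (8 : R)^-1 = (2^-1) * (2^-1) * 2^-1 by field.
  by rewrite !exprMn !exprVn; field; rewrite expf_neq0.
apply: ler_piMl => //; case: d d0 {xd xT P Pd h} => // d _.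
by rewrite exprS mulrA mulfV// mul1r exprn_ile1// ?invr_ge0// invf_le1// ler1n.
Qed.

(** A ball of radius [|a| / 2] around the vector with the single entry [a], at the root, contains no
    periodic point: its other coordinates would be below [|a| / 2] and force the root entry to be at
    most [|a| / 2], too far from [a]. *)
Lemma not_chaotic_BT : (exists a : E, a != 0) -> ~ chaotic (BT p1 J _ cT).
Proof.
move=> [a a0] [_ dns].
have [k _] : exists k : index_set J, True by case: J; [exists 0|exists 0].
pose y := single p1 k (single (lexx 1) ([::] : seq nat) a).
have a20 : 0 < `|a| / 2 by rewrite divr_gt0// normr_gt0.
have [|x [yx xper]] := dns (ball y (`|a| / 2)) _ (ball_open _ _).
  by exists y; exact: ballxx.
move: yx; rewrite -ball_normE/= => yx.
have xk := le_lt_trans (lp_coord_le (y - x) _) yx.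
have : `|x k [::]| <= `|a| / 2.
  apply: periodic_bound xper _ => i /eqP /negbTE ik; apply: ltW.
  by have := xk i; rewrite lpDE lpNE singleE ik sub0r normrN.
have := le_lt_trans (lp_coord_le ((y - x) k) [::]) (xk k).
rewrite lpDE lpNE singleE eqxx lpDE lpNE singleE eqxx => a1 a2.
have := ler_normD (a - x k [::]) (x k [::]); rewrite subrK.
by apply/negP; rewrite -ltNge [ltRHS]splitr ltr_leD.
Qed.

End countdown_shift.

(** * Positive lower density and the visit times *)

Lemma lower_density_gt0 (R : realType) (A : set nat) (f : nat -> nat) q :
  injective f -> (forall i, A (f i)) -> (forall i, (f i < q * i.+1)%N) ->
  (0 < lower_density R A)%E.
Proof.
move=> fI Af fq.
have q0 : (0 < q)%N by have := fq 0; rewrite muln1; case: q {fq}.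
(* The values of [f] at all [i < N.+1 %/ q] are distinct members of the set up to [N]. Once
   [q <= N.+1], rounding down loses at most a factor 2, hence the bound [1 / (2 q)] below. *)
have count N : (N.+1 %/ q <= #|[pred n : 'I_N.+1 | `[< A n >]]|)%N.
  have fN (i : 'I_(N.+1 %/ q)) : (f i < N.+1)%N.
    apply: leq_trans (fq i) _; apply: leq_trans (leq_trunc_div N.+1 q).
    by rewrite mulnC leq_mul2r ltn_ord orbT.
  have gI : injective (fun i => Ordinal (fN i)).
    by move=> i j [/fI ij]; exact: val_inj.
  rewrite -[X in (X <= _)%N]card_ord -(fintype.card_image gI).
  apply/subset_leq_card/fintype.subsetP => n /fintype.imageP[i _ ->].
  by rewrite inE /=; exact: Af.
have q2 : (0 : R) < (2 * q%:R)^-1 by rewrite invr_gt0 mulr_gt0// ltr0n.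
have dens N : (q <= N.+1)%N -> (2 * q%:R)^-1 <=
    #|[pred n : 'I_N.+1 | `[< A n >]]|%:R / N.+1%:R :> R.
  move=> qN; rewrite ler_pdivlMr// ler_pdivrMl ?mulr_gt0 ?ltr0n//.
  rewrite -natrM -natrM ler_nat.
  apply: (@leq_trans (2 * q * (N.+1 %/ q))); last first.
    by rewrite leq_mul2l count orbT.
  have c1 : (0 < N.+1 %/ q)%N by rewrite divn_gt0.
  by have := ltn_ceil N.+1 q0; nia.
rewrite /lower_density limn_einf_lim (cvg_lim _ (@cvg_einfs_sup R _))//.
apply: (@lt_le_trans _ _ ((2 * q%:R)^-1)%:E); first by rewrite lte_fin.
apply: le_trans (ereal_sup_ubound _); last by exists q.
apply: le_ereal_inf_tmp => _ [N /= qN <-].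
by rewrite lee_fin; apply: dens; exact: ltnW.
Qed.

(** The ruler sequence: each value [t] is taken along an arithmetic progression of difference
    [2 ^ t.+1]. It assigns the target of rank [nu k] to the [k]-th visit. *)
Definition nu k : nat := logn 2 k.+1.

Definition nu_sum k : nat := \sum_(i < k) (nu i).+1.

(* [tau k - tau j >= nu j + nu k] for [j < k]: the visits of rank [t] are at
   distance at least [t] from all other visits. *)
Definition tau k : nat := nu_sum k + nu_sum k.+1.

Lemma nu_sumS k : nu_sum k.+1 = (nu_sum k + (nu k).+1)%N.
Proof. by rewrite /nu_sum big_ord_recr. Qed.

Lemma nu_double k : nu k.*2.+1 = (nu k).+1.
Proof. by rewrite /nu -doubleS -mul2n lognM// logn_prime. Qed.

Lemma nu_double0 k : nu k.*2 = 0.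
Proof. by apply/logn_coprime; rewrite prime_coprime// dvdn2 /= odd_double. Qed.

Lemma nu_sum_double k : nu_sum k.*2 = (k.*2 + nu_sum k)%N.
Proof.
elim: k => [|k ih]; first by rewrite /nu_sum !big_ord0.
by rewrite doubleS !nu_sumS ih nu_double nu_double0; lia.
Qed.

(** Strong induction through [nu_sum_double]. This linear growth is what keeps the visit times of
    positive lower density. *)
Lemma nu_sum_le k : (nu_sum k <= k.*2)%N.
Proof.
elim/ltn_ind: k => k ih; rewrite -(odd_double_half k).
have [k0|k0] := posnP k; first by rewrite k0 /nu_sum big_ord0.
have := ih k./2; rewrite -{1}divn2 ltn_Pdiv// => /(_ isT).
case: (odd k); rewrite ?add0n ?add1n ?nu_sumS nu_sum_double ?nu_double0; lia.
Qed.

Lemma tau_lt k : (tau k < 4 * k.+1)%N.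
Proof. by have := nu_sum_le k; have := nu_sum_le k.+1; rewrite /tau; lia. Qed.

Lemma nu_sum_mono j d : (nu_sum j + d <= nu_sum (d + j))%N.
Proof. by elim: d => [|d ih]; rewrite ?addn0// addSn nu_sumS; lia. Qed.

Lemma tau_ge k : (nu k + k.*2 < tau k)%N.
Proof.
have := nu_sum_mono 0 k; rewrite addn0 {1}/nu_sum big_ord0.
by rewrite /tau nu_sumS; lia.
Qed.

(** In the difference of the two times the summands [(nu j).+1] and [(nu k).+1] remain once each,
    and every summand strictly between remains twice. *)
Lemma tau_sep j k : (j < k)%N -> (tau j + nu j + nu k + (k - j).*2 <= tau k)%N.
Proof.
move=> jk; have := nu_sum_mono j.+1 (k - j.+1); rewrite subnK//.
by rewrite /tau !nu_sumS; lia.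
Qed.

Lemma nu_pow2 t i : nu (2 ^ t * i.*2.+1).-1 = t.
Proof.
rewrite /nu prednK ?muln_gt0 ?expn_gt0// lognM ?expn_gt0// pfactorK//.
rewrite [X in (_ + X)%N]logn_coprime ?addn0//.
by rewrite prime_coprime// dvdn2/= odd_double.
Qed.

Lemma tau_inj : injective tau.
Proof.
by move=> j k; case: (ltngtP j k) => // jk; have := tau_sep jk; lia.
Qed.

(** The indices of rank [t] are those with [k.+1 = 2 ^ t * i.*2.+1]; along them [tau] is below
    [8 * 2 ^ t * i.+1]. *)
Lemma frequent_visits (R : realType) (A : set nat) t :
  (forall k, nu k = t -> A (tau k)) -> (0 < lower_density R A)%E.
Proof.
move=> At; pose r i := (2 ^ t * i.*2.+1).-1.
have rS i : (r i).+1 = (2 ^ t * i.*2.+1)%N.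
  by rewrite prednK// muln_gt0 expn_gt0.
apply: (@lower_density_gt0 _ _ (tau \o r) (8 * 2 ^ t)).
- apply: inj_comp tau_inj _ => i j /(congr1 S); rewrite !rS => /eqP.
  by rewrite eqn_pmul2l ?expn_gt0//; lia.
- by move=> i; apply: At; exact: nu_pow2.
- move=> i; apply: leq_trans (tau_lt _) _; rewrite rS.
  by have := expn_gt0 2 t; nia.
Qed.

(** * A criterion for frequent hypercyclicity *)

Section criterion.
Context {R : realType} {Y : completeNormedModType R} (B : {linear Y -> Y}).
Context (M : R) (BM : forall x, `|B x| <= M * `|x|).
Context (z u : nat -> Y).
Context (Bu_eq : forall k, iter (tau k) B (u k) = z (nu k))
  (Bu_lt : forall j k, (j < k)%N -> iter (tau k) B (u j) = 0)
  (Bu_gt : forall j k, (j < k)%N ->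
     `|iter (tau j) B (u k)| <= 2^-1 ^+ (nu j + (k - j)))
  (u_le : forall k, `|u k| <= 2^-1 ^+ k).
Context (z_dense : forall U : set Y, open U -> U !=set0 ->
  exists t, forall x, `|x - z t| <= 2^-1 ^+ t -> U x).

Let iterD n x y : iter n B (x + y) = iter n B x + iter n B y.
Proof. by elim: n => //= n ->; rewrite linearD. Qed.

Let iter_le n x : `|iter n B x| <= `|M| ^+ n * `|x|.
Proof.
elim: n => [|n ih]; first by rewrite mul1r.
rewrite iterS (le_trans (BM _))// exprS -mulrA.
apply: (@le_trans _ _ (`|M| * `|iter n B x|)); last by rewrite ler_wpM2l.
by rewrite ler_wpM2r// ler_norm.
Qed.

Let cvg_u : cvgn (series u).
Proof.
apply: normed_cvg; apply: (@series_le_cvg _ _ (geometric 1 2^-1)).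
- by move=> n; exact: normr_ge0.
- by move=> n; rewrite /geometric/= mul1r exprn_ge0// invr_ge0.
- by move=> n; rewrite /geometric/= mul1r.
- apply: is_cvg_geometric_series.
  by rewrite ger0_norm ?invr_ge0// invf_lt1// ltr1n.
Qed.

(** At time [tau j] the terms before [j] have vanished, the term [j] gives the target, and the next
    [d] terms add errors forming a geometric sum. *)
Let iter_series j d :
  `|iter (tau j) B (series u (d + j.+1)%N) - z (nu j)| <=
  2^-1 ^+ nu j * (1 - 2^-1 ^+ d).
Proof.
elim: d => [|d ih].
  rewrite expr0 subrr mulr0 add0n /series/= big_nat_recr//= iterD Bu_eq.
  rewrite addrK; suff -> : iter (tau j) B (\sum_(0 <= k < j) u k) = 0.
    by rewrite normr0.
  suff h i : (i <= j)%N -> iter (tau j) B (\sum_(0 <= k < i) u k) = 0.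
    exact: h.
  elim: i => [_|i ih ij]; last first.
    by rewrite big_nat_recr//= iterD (ih (ltnW ij)) Bu_lt// addr0.
  by rewrite big_geq//; elim: (tau j) => //= n ->; rewrite linear0.
rewrite addSn /series/= big_nat_recr//= iterD addrAC.
apply: le_trans (ler_normD _ _) _.
have jk : (j < d + j.+1)%N by lia.
apply: le_trans (lerD ih (Bu_gt jk)) _.
have -> : (d + j.+1 - j = d.+1)%N by lia.
rewrite exprD -mulrDr; apply: ler_wpM2l; first by rewrite exprn_ge0// invr_ge0.
by rewrite exprS; lra.
Qed.

(** The vector is the sum of all [u k]. For a fixed visit the iterate is bounded, so the estimate on
    partial sums passes to the limit. The rank [t] serves both as the index of the target and as its
    accuracy [2^-t]. *)
Lemma frequently_hypercyclic_criterion : frequently_hypercyclic B.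
Proof.
exists (limn (series u)) => U oU U0; have [t tU] := z_dense oU U0.
apply: (@frequent_visits _ _ t) => k kt; rewrite -kt in tU.
apply: tU; apply/ler_addgt0Pr => e e0.
have c0 : 0 < `|M| ^+ tau k + 1 by rewrite ltr_wpDl// exprn_ge0.
have /cvgrPdist_le/(_ (e / (`|M| ^+ tau k + 1))) := cvg_u.
rewrite divr_gt0// => /(_ isT)[N _ /(_ (N + k.+1)%N)] /=.
rewrite leq_addr => /(_ isT) hN.
rewrite -[limn _](subrK (series u (N + k.+1))) iterD -addrA.
apply: le_trans (ler_normD _ _) _; rewrite [leRHS]addrC; apply: lerD.
  apply: le_trans (iter_le _ _) _.
  apply: (@le_trans _ _ ((`|M| ^+ tau k + 1) * (e / (`|M| ^+ tau k + 1)))).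
    by apply: ler_pM => //; rewrite lerDl.
  by rewrite mulrCA divff ?gt_eqF// mulr1.
apply: le_trans (iter_series k N) _; apply: ler_piMr.
  by rewrite exprn_ge0// invr_ge0.
by rewrite gerBl exprn_ge0// invr_ge0.
Qed.

End criterion.

(** * Linearity and boundedness of [BT] *)

Section BT_linear.
Context {R : realType} {p : R} (p1 : 1 <= p) (J : index_kind)
  {X : normedModType R} (T : {linear X -> X}) (cT : continuous T).

Lemma BT_linear : linear (BT p1 J T cT).
Proof.
by move=> c x y; apply: lp_ext => k; rewrite lpDE lpZE; exact: linearP.
Qed.

HB.instance Definition _ := GRing.isLinear.Build R (lp p1 (index_set J) X)
  (lp p1 (index_set J) X) _ (BT p1 J T cT) BT_linear.

Lemma norm_BT (M : R) x : 0 <= M -> (forall y, `|T y| <= M * `|y|) ->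
  `|BT p1 J T cT x| <= M * `|x|.
Proof.
move=> M0 TM; have p0 : 0 <= p by exact: le_trans p1.
apply: lp_norm_le; first by rewrite mulr_ge0.
apply: (@le_trans _ _ (\esum_(k in [set: index_set J])
    ((M `^ p)%:E * (`|x (index_succ k)| `^ p)%:E))%E).
  apply: le_esum => k _; rewrite -EFinM lee_fin -powRM//.
  by apply: ge0_ler_powR; rewrite ?nnegrE// ?mulr_ge0//; exact: TM.
apply: le_trans (esum_mule_le _ _ _) _; first exact: powR_ge0.
  by move=> k; rewrite lee_fin powR_ge0.
rewrite powRM// EFinM; apply: lee_wpmul2l; first by rewrite lee_fin powR_ge0.
rewrite -lp_esumE -(esum_image _ _ (fun k => (`|x k| `^ p)%:E)); last first.
  by move=> ? ? _ _; exact: index_succ_inj.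
rewrite esum_mkcond; apply: le_esum => k _.
by case: ifP => // _; rewrite lee_fin powR_ge0.
Qed.

End BT_linear.

Section iter_linear.
Context {R : realType} {Y : lmodType R} (B : {linear Y -> Y}).

Lemma iter_linear0 n : iter n B 0 = 0.
Proof. by elim: n => //= n ->; rewrite linear0. Qed.

Lemma iter_linear_sum n (K : Type) (s : seq K) (f : K -> Y) :
  iter n B (\sum_(i <- s) f i) = \sum_(i <- s) iter n B (f i).
Proof. by elim: n => //= n ->; rewrite linear_sum. Qed.

End iter_linear.

Lemma iter_index_succ_inj (J : index_kind) n :
  injective (iter n (@index_succ J)).
Proof. by elim: n => [|n ih] k l //= /index_succ_inj/ih. Qed.

(** The product of the weights along the path from the root to [u]; the quotient
    [lam (w ++ v) / lam v] is the factor picked up on the way from [w ++ v] back to [v]. *)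
Fixpoint lam (R : realType) (u : seq nat) : R :=
  if u is j :: v then wt R u * lam R v else 1.

(** * Preimages along countdown branches, and frequent hypercyclicity *)

Section branches.
Context {R : realType}.
Implicit Types u v w : seq nat.

Lemma lam_cons j v : lam R (j :: v) = wt R (j :: v) * lam R v.
Proof. by []. Qed.

Lemma lam_gt0 u : 0 < lam R u.
Proof. by elim: u => [|j v ih]; rewrite ?ltr01// lam_cons mulr_gt0 ?wt_gt0. Qed.

(** The edge out of [v] has weight at least [8^-1 ^+ size v], whether or not it continues a
    countdown; the other [l] edges have weight 2. *)
Lemma lam_iota n l v :
  lam R v * 8^-1 ^+ size v * 2 ^+ l <= lam R (iota n l.+1 ++ v).
Proof.
elim: l n => [|l ih] n.
  rewrite lam_cons mulr1 [leLHS]mulrC ler_pM2r ?lam_gt0//=; case: ifP => // _.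
  by rewrite (@le_trans _ _ 1)// ?ler1n// exprn_ile1// invf_le1// ler1n.
rewrite [iota _ _]/= cat_cons lam_cons [wt _ _]/= eqxx exprS mulrCA ler_pM2l//.
exact: ih.
Qed.

Context {E : completeNormedModType R}.

Lemma cshift_single_root (a : E) : cshift (single (lexx 1) [::] a) = 0.
Proof. exact: tree_shift_single_root. Qed.

Lemma cshift_single j v (a : E) :
  cshift (single (lexx 1) (j :: v) a) = single (lexx 1) v (wt R (j :: v) *: a).
Proof. exact/tree_shift_single/seq_edge_cons. Qed.

Lemma iter_cshift_single w v (a : E) :
  iter (size w) cshift (single (lexx 1) (w ++ v) a) =
  single (lexx 1) v ((lam R (w ++ v) / lam R v) *: a).
Proof.
elim: w a => [|j w ih] a.
  by rewrite divff ?gt_eqF ?lam_gt0// scale1r.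
rewrite [size _]/= iterSr cat_cons cshift_single ih scalerA lam_cons.
by rewrite mulrC mulrA.
Qed.

Lemma iter_cshift_single0 n v (a : E) : (size v < n)%N ->
  iter n cshift (single (lexx 1) v a) = 0.
Proof.
move=> vn; rewrite -(subnK vn) iterD iterS -{3}[v]cats0 iter_cshift_single.
by rewrite cshift_single_root iter_linear0.
Qed.

Context {p : R} (p1 : 1 <= p) (J : index_kind) (cT : continuous (@cshift R E)).
Local Notation B := (BT p1 J _ cT).

Definition dsingle (d : index_set J * seq nat * E) :
    lp p1 (index_set J) (l1 (seq nat) E) :=
  single p1 d.1.1 (single (lexx 1) d.1.2 d.2).

Lemma norm_dsingle d : `|dsingle d| = `|d.2|.
Proof. by rewrite !norm_single. Qed.

Lemma iter_B_dsingle k w v a :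
  iter (size w) B (dsingle (iter (size w) index_succ k, w ++ v, a)) =
  dsingle (k, v, (lam R (w ++ v) / lam R v) *: a).
Proof.
apply: lp_ext => l; rewrite iter_BTE /dsingle !singleE/=.
rewrite (inj_eq (@iter_index_succ_inj _ _)); case: eqP => _.
  exact: iter_cshift_single.
exact: iter_linear0.
Qed.

Lemma iter_B_dsingle0 n d : (size d.1.2 < n)%N -> iter n B (dsingle d) = 0.
Proof.
move=> dn; apply: lp_ext => l; rewrite iter_BTE /dsingle !singleE/=.
by case: eqP => _; [exact: iter_cshift_single0|exact: iter_linear0].
Qed.

Definition vec (s : seq (index_set J * seq nat * E)) := \sum_(d <- s) dsingle d.

(* [lift_vec 0 n s] is a preimage of [vec s] under the n-th iterate of [B], and
   [lift_vec m n s] is the m-th iterate of [B] at [lift_vec 0 (m + n) s]. *)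
Definition lift_vec m n (s : seq (index_set J * seq nat * E)) :=
  \sum_(d <- s) dsingle (iter n index_succ d.1.1, iota m n ++ d.1.2,
    (lam R d.1.2 / lam R (iota m n ++ d.1.2)) *: d.2).

(** The powers of 8 compensate the worst weight of the edge that starts a countdown above each
    vertex. *)
Definition cost (s : seq (index_set J * seq nat * E)) :=
  \sum_(d <- s) `|d.2| * 8 ^+ size d.1.2.

Lemma lift_vec0 m s : lift_vec m 0 s = vec s.
Proof.
apply: eq_bigr => -[[k v] a] _ /=.
by rewrite divff ?gt_eqF ?lam_gt0// scale1r.
Qed.

Lemma iter_B_lift_vec m n l s :
  iter n B (lift_vec m (n + l) s) = lift_vec (m + n) l s.
Proof.
rewrite iter_linear_sum; apply: eq_bigr => -[[k v] a] _ /=.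
rewrite iterD iotaD -catA -{1 2}(size_iota m n) iter_B_dsingle scalerA.
congr (dsingle (_, _, _ *: _)).
rewrite mulrC mulrA divfK ?gt_eqF ?lam_gt0//.
Qed.

(** By [lam_iota], of the [l.+1] edges all but the first double. The bound is uniform in the offset
    [m], so it applies at all earlier visits. *)
Lemma norm_lift_vec m l s :
  `|lift_vec m l.+1 s| <= cost s * 2^-1 ^+ l.
Proof.
apply: le_trans (ler_norm_sum _ _ _) _; rewrite /cost mulr_suml.
apply: ler_sum => -[[k v] a] _; rewrite norm_dsingle.
rewrite -[(k, v, a).1.2]/v -[(k, v, a).2]/a.
set r := _ / _; rewrite -[(_, _).2]/(r *: a) normrZ {}/r.
rewrite mulrC -mulrA; apply: ler_wpM2l => //.
rewrite ger0_norm ?divr_ge0 ?(ltW (lam_gt0 _))// ler_pdivrMr ?lam_gt0//.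
apply: le_trans (ler_wpM2l _ (lam_iota m l v)); last first.
  by rewrite mulr_ge0// exprn_ge0// invr_ge0.
rewrite le_eqVlt; apply/orP; left; apply/eqP.
have a0 : (8 : R) ^+ size v * 8^-1 ^+ size v = 1.
  by rewrite -exprMn mulfV ?expr1n.
have b0 : (2 : R)^-1 ^+ l * 2 ^+ l = 1 by rewrite -exprMn mulVf ?expr1n.
by rewrite -[LHS]mulr1 -[X in _ * X]b0 -[LHS]mulr1 -[X in _ * X]a0; ring.
Qed.

Lemma iter_B_vec n s : all (fun d => (size d.1.2 < n)%N) s ->
  iter n B (vec s) = 0.
Proof.
move=> /allP sn; rewrite iter_linear_sum big1_seq// => d /= ds.
exact/iter_B_dsingle0/sn.
Qed.

Lemma frequently_hypercyclic_BT
    (st : nat -> seq (index_set J * seq nat * E)) :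
  (forall t, cost (st t) <= 2 ^+ t) ->
  (forall t, all (fun d => (size d.1.2 <= t)%N) (st t)) ->
  (forall U : set (lp p1 (index_set J) (l1 (seq nat) E)), open U -> U !=set0 ->
    exists t, forall x, `|x - vec (st t)| <= 2^-1 ^+ t -> U x) ->
  frequently_hypercyclic B.
Proof.
move=> st_cost st_size st_dense.
have pow2 a b c : (a + c <= b)%N -> (2 : R) ^+ a * 2^-1 ^+ b <= 2^-1 ^+ c.
  move=> abc; rewrite -(subnKC abc) !exprD !mulrA -exprMn mulfV// expr1n mul1r.
  rewrite ler_piMr ?exprn_ge0 ?invr_ge0//.
  by rewrite exprn_ile1 ?invr_ge0// invf_le1// ler1n.
have liftE n k : (n <= tau k)%N ->
    iter n B (lift_vec 0 (tau k) (st (nu k))) =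
    lift_vec n (tau k - n) (st (nu k)).
  by move=> nk; rewrite -{1}(subnKC nk) iter_B_lift_vec.
have liftN n k c : (n < tau k)%N -> (nu k + c <= (tau k - n).-1)%N ->
    `|iter n B (lift_vec 0 (tau k) (st (nu k)))| <= 2^-1 ^+ c.
  move=> nk ck; rewrite liftE 1?ltnW// -(prednK (n := (tau k - n))) ?subn_gt0//.
  apply: le_trans (norm_lift_vec _ _ _) (le_trans _ (pow2 _ _ _ ck)).
  by apply: ler_wpM2r; rewrite ?exprn_ge0 ?invr_ge0.
apply: (@frequently_hypercyclic_criterion _ _ _ 2 _ (fun t => vec (st t))
  (fun k => lift_vec 0 (tau k) (st (nu k)))) => //.
- by move=> x; apply: norm_BT => // y; exact: norm_cshift.
- by move=> k; rewrite liftE// subnn lift_vec0.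
(* At time [tau j] the earlier vector has become its target, of depth at most [nu j], which is less
   than the time left until [tau k]. *)
- move=> j k jk; have := tau_sep jk => tjk.
  have jk' : (tau j <= tau k)%N by lia.
  rewrite -(subnK jk') iterD liftE// subnn lift_vec0 iter_B_vec//.
  by apply: sub_all (st_size (nu j)) => d; lia.
(* The cost [2 ^+ nu k] and the one edge without doubling are absorbed by the separation, whose
   surplus [(k - j).*2] also leaves [k - j]. *)
- by move=> j k jk; have := tau_sep jk => tjk; apply: liftN; lia.
- by move=> k; have := tau_ge k => tk; apply: (liftN 0); lia.
Qed.

End branches.

(** * A dense sequence of finitely supported targets *)

Definition dense_sequence (R : realType) (E : normedModType R) (q : nat -> E) :=
  forall a e, 0 < e -> exists n, `|a - q n| < e.

Section enumeration.
Context {R : realType} {E : completeNormedModType R} (q : nat -> E)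
  (qd : dense_sequence q).
Context {p : R} (p1 : 1 <= p) (J : index_kind).
Local Notation Y := (lp p1 (index_set J) (l1 (seq nat) E)).
Local Notation data := (seq (index_set J * seq nat * E)).

Lemma index_enum : exists f : nat -> index_set J, forall k, exists n, f n = k.
Proof.
case: J => /=; first by exists id => k; exists k.
exists (fun n => odflt (0 : int) (choice.unpickle n : option int)) => k.
exists (choice.pickle k).
by rewrite choice.pickleK.
Qed.

Lemma datum_enum : exists D : nat -> index_set J * seq nat * E,
  forall k v a e, 0 < e -> exists n a', D n = (k, v, a') /\ `|a - a'| < e.
Proof.
have [f fS] := index_enum.
pose code n := odflt (0, [::], 0)
  (choice.unpickle n : option (nat * seq nat * nat)).
exists (fun n => let: (i, v, j) := code n in (f i, v, q j)) => k v a e e0.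
have [i fi] := fS k; have [j aj] := qd a e0.
exists (choice.pickle (i, v, j)), (q j); split=> //.
by rewrite /code choice.pickleK /= fi.
Qed.

Lemma vec_cat (s t : data) : vec p1 (s ++ t) = vec p1 s + vec p1 t.
Proof. by rewrite /vec big_cat. Qed.

Section approximation.
Context (D : nat -> index_set J * seq nat * E)
  (DP : forall k v a e, 0 < e ->
    exists n a', D n = (k, v, a') /\ `|a - a'| < e).

Let approx (y : Y) := forall e, 0 < e ->
  exists l : seq nat, `|y - vec p1 (map D l)| < e.

Let approx_lim (y : Y) :
  (forall e, 0 < e -> exists2 y', approx y' & `|y - y'| < e) -> approx y.
Proof.
move=> h e e0; have e2 : 0 < e / 2 by rewrite divr_gt0.
have [y' ay' yy'] := h _ e2; have [l y'l] := ay' _ e2.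
exists l; rewrite -(subrK y' y) -addrA [e]splitr.
exact: le_lt_trans (ler_normD _ _) (ltrD yy' y'l).
Qed.

Let approx_sum (K : Type) (s : seq K) (g : K -> Y) :
  (forall i, approx (g i)) -> approx (\sum_(i <- s) g i).
Proof.
move=> ag; elim: s => [|i s ih] e e0.
  by exists [::]; rewrite /vec !big_nil subr0 normr0.
have e2 : 0 < e / 2 by rewrite divr_gt0.
have [l gl] := ag i _ e2; have [l' sl'] := ih _ e2.
exists (l ++ l'); rewrite big_cons map_cat vec_cat opprD addrACA [e]splitr.
exact: le_lt_trans (ler_normD _ _) (ltrD gl sl').
Qed.

Let approx_dsingle k v a : approx (dsingle p1 (k, v, a)).
Proof.
move=> e /(DP k v a)[n [a' [Dn aa']]]; exists [:: n].
by rewrite /vec big_seq1 Dn /dsingle/= -!singleB !norm_single.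
Qed.

(** Truncation first in the index set, then in the tree inside each coordinate, reduces the claim to
    single entries, where only the scalar has to be approximated. *)
Lemma vec_dense (y : Y) e : 0 < e ->
  exists l : seq nat, `|y - vec p1 (map D l)| < e.
Proof.
move: e; apply: approx_lim => e e0.
have [A yA] := lp_trunc_dense y e0.
exists (trunc p1 A y) => //; apply: approx_sum => k {A yA}.
apply: approx_lim => {e e0} e e0.
have [A yA] := lp_trunc_dense (y k) e0.
exists (single p1 k (trunc _ A (y k))); last by rewrite -singleB norm_single.
rewrite /trunc single_sum; apply: approx_sum => v.
exact: approx_dsingle.
Qed.

End approximation.

Lemma injective_unbounded (f : nat -> nat) n :
  injective f -> exists i, (n <= f i)%N.
Proof.
move=> fI; apply: contrapT => /forallNP fn.
have fn' i : (f i < n)%N by rewrite ltnNge; apply/negP/fn.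
have /leq_card : injective (fun i : 'I_n.+1 => Ordinal (fn' i)).
  by move=> i j [/fI ij]; exact: val_inj.
by rewrite !card_ord ltnn.
Qed.

(* The codes carry a dummy component, so that every list of data occurs at
   arbitrarily large indices [t], where its cost is at most [2 ^ t] and its depth
   at most [t]. *)
Lemma data_enum : exists st : nat -> data,
  [/\ forall t, cost (st t) <= 2 ^+ t,
      forall t, all (fun d => (size d.1.2 <= t)%N) (st t) &
      forall U : set Y, open U -> U !=set0 ->
        exists t, forall x, `|x - vec p1 (st t)| <= 2^-1 ^+ t -> U x].
Proof.
have [D DP] := datum_enum.
pose raw t : data :=
  map D (odflt (0, [::]) (choice.unpickle t : option (nat * seq nat))).2.
(* Codes violating a bound are replaced by the empty list, so both bounds hold for every [t]. *)
pose ok t := (cost (raw t) <= 2 ^+ t) &&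
  all (fun d => (size d.1.2 <= t)%N) (raw t).
exists (fun t => if ok t then raw t else [::]); split.
- move=> t; case: ifP => [/andP[]//|_].
  by rewrite /cost big_nil exprn_ge0.
- by move=> t; case: ifP => [/andP[]|].
move=> U oU [x Ux].
have /nbhs_ballP[e /= e0 eU] := open_nbhs_nbhs (conj oU Ux).
have e2 : 0 < e / 2 by rewrite divr_gt0.
have [l xl] := vec_dense DP x e2.
(* A code beyond all three numbers meets the bound on the cost, the bound on the depth, and
   [2^-t <= e / 2]. *)
pose N1 := Num.truncn (cost (map D l)).
pose N2 := \max_(d <- map D l) size d.1.2.
pose N3 := Num.truncn (e / 2)^-1.
have [|c tN] := @injective_unbounded (fun c => choice.pickle (c, l))
    (N1 + N2 + N3).+1.
  by move=> i j /(pcan_inj choice.pickleK)[].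
pose t := choice.pickle (c, l); exists t; rewrite -/t in tN.
have rawt : raw t = map D l by rewrite /raw /t choice.pickleK.
have pow2 : (t%:R : R) <= 2 ^+ t.
  by rewrite -natrX ler_nat ltnW// ltn_expl.
have tr (r : R) : (Num.truncn r < t)%N -> r <= 2 ^+ t.
  move=> rt; apply: le_trans pow2.
  apply: le_trans (ltW (Num.Theory.truncnS_gt r)) _.
  by rewrite ler_nat.
have okt : ok t.
  apply/andP; rewrite rawt; split; first by apply: tr; rewrite -/N1; lia.
  apply/allP => d dl; apply: (@leq_trans N2); last by lia.
  by rewrite /N2 (big_rem d)//= leq_maxl.
move=> x'; rewrite okt rawt => x't; apply: eU.
rewrite -ball_normE/= -(subrK (vec p1 (map D l)) x) -addrA [e]splitr.
apply: le_lt_trans (ler_normD _ _) (ltr_leD xl _).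
rewrite distrC; apply: le_trans x't _.
rewrite exprVn -[leRHS]invrK lef_pV2 ?posrE ?exprn_gt0 ?invr_gt0//.
by apply: tr; rewrite -/N3; lia.
Qed.

End enumeration.

(** Real and complex scalars are treated at once: the weights are real multiples of the unit, so
    multiplying by them is real scaling. *)
Lemma fhc_not_chaotic_shift (R : realType) (E : completeNormedModType R)
    (q : nat -> E) (qd : dense_sequence q) (mul : E -> E -> E) (one : E)
    (mulZ : forall c x, mul (c *: one) x = c *: x) (one0 : one != 0)
    (p : R) (p1 : 1 <= p) (J : index_kind) :
  exists (V : countType) (edge : rel V) (root : V) (lambda : V -> E)
         (T : {linear l1 V E -> l1 V E}) (cT : continuous T),
    [/\ rooted_tree edge root,
        (forall v, lambda v != 0),
        (forall (x : l1 V E) (v : V), summability.partial_sum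
           (fun u : Chi edge v => mul (lambda (val u)) (x (val u)))
           @ summability.totally --> T x v),
        frequently_hypercyclic (BT p1 J T cT) &
        ~ chaotic (BT p1 J T cT)].
Proof.
have cT : continuous (@cshift R E) by exact: tree_shift_continuous.
exists (seq nat), seq_edge, [::], (fun v => wt R v *: one), (@cshift R E), cT.
split.
- exact: seq_rooted_tree.
- by move=> v; rewrite scaler_eq0 negb_or one0 gt_eqF// wt_gt0.
- move=> x v.
  have -> : (fun u : Chi seq_edge v => mul (wt R (val u) *: one) (x (val u))) =
      @chi_fun _ _ _ (wt R) _ x v.
    by apply/funext => u; rewrite mulZ.
  exact: l1_sum_cvg.
- have [st [st_cost st_size st_dense]] := data_enum qd p1 J.
  exact: frequently_hypercyclic_BT st_cost st_size st_dense.
- by apply: not_chaotic_BT; exists one.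
Qed.

(** * Completeness and separability of the scalar fields *)

Section Rcomplex_complete.
Context {R : realType}.
Implicit Types z : Rcomplex R.

Lemma Rcomplex_normE z :
  `|z| = Num.sqrt (complex.Re z ^+ 2 + complex.Im z ^+ 2).
Proof. by case: z. Qed.

Lemma normr_Re_le z : `|complex.Re z| <= `|z|.
Proof.
rewrite Rcomplex_normE -sqrtr_sqr ler_wsqrtr//.
by rewrite lerDl sqr_ge0.
Qed.

Lemma normr_Im_le z : `|complex.Im z| <= `|z|.
Proof.
rewrite Rcomplex_normE -sqrtr_sqr ler_wsqrtr//.
by rewrite lerDr sqr_ge0.
Qed.

Lemma Rcomplex_norm_le z : `|z| <= `|complex.Re z| + `|complex.Im z|.
Proof.
rewrite Rcomplex_normE -[leRHS]ger0_norm ?addr_ge0// -sqrtr_sqr ler_wsqrtr//.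
by rewrite sqrrD !real_normK ?num_real// addrAC lerDl mulrn_wge0 ?mulr_ge0.
Qed.

Lemma Rcomplex_complete (F : set_system (Rcomplex R)) :
  ProperFilter F -> cauchy F -> cvg F.
Proof.
move=> FF /cauchy_ballP Fc.
have part (f : {additive Rcomplex R -> R}) :
    (forall z, `|f z| <= `|z|) -> cvg (f @ F).
  move=> fle; apply: (@cauchy_cvg R^o); apply/cauchy_ballP => e e0.
  have [[A B] /= [FA FB] AB] := Fc e e0.
  exists (f @` A, f @` B).
    by split; [apply: (@filterS _ F _ A)|apply: (@filterS _ F _ B)] => // z;
      exists z.
  move=> [_ _] [/= [z Az <-] [z' Bz' <-]]; rewrite -ball_normE/= -raddfB.
  apply: le_lt_trans (fle _) _.
  by have := AB (z, z') (conj Az Bz'); rewrite -ball_normE.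
have /cvg_ex[a Fa] := part (@complex.Re R) normr_Re_le.
have /cvg_ex[b Fb] := part (@complex.Im R) normr_Im_le.
apply/cvg_ex; exists (complex.Complex a b : Rcomplex R).
apply/cvgrPdist_lt => e e0; have e2 : 0 < e / 2 by rewrite divr_gt0.
move/cvgrPdist_lt : Fa => /(_ _ e2); move/cvgrPdist_lt : Fb => /(_ _ e2).
apply: filterS2 => z zb za; apply: le_lt_trans (Rcomplex_norm_le _) _.
by rewrite [e]splitr !raddfB ltrD.
Qed.

HB.instance Definition _ := Uniform_isComplete.Build (Rcomplex R)
  Rcomplex_complete.

End Rcomplex_complete.

Lemma real_dense_sequence (R : realType) :
  exists q : nat -> R^o, dense_sequence q.
Proof.
exists (fun n => ratr (odflt 0 (choice.unpickle n : option rat))) => a e e0.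
have /rat_in_itvoo[r] : a < a + e by rewrite ltrDl.
rewrite in_itv/= => /andP[ar re]; exists (choice.pickle r).
rewrite choice.pickleK/= ltr_distlC ltrBlDr re andbT.
by rewrite (lt_trans ar)// ltrDl.
Qed.

Lemma complex_dense_sequence (R : realType) :
  exists q : nat -> Rcomplex R, dense_sequence q.
Proof.
have [q qd] := real_dense_sequence R.
exists (fun n => let: (i, j) :=
  odflt (0, 0) (choice.unpickle n : option (nat * nat)) in
  complex.Complex (q i) (q j)) => -[a b] e e0.
have e2 : 0 < e / 2 by rewrite divr_gt0.
have [i ai] := qd a _ e2; have [j bj] := qd b _ e2.
exists (choice.pickle (i, j)); rewrite choice.pickleK /=.
apply: le_lt_trans (Rcomplex_norm_le _) _.
by rewrite [e]splitr; exact: (ltrD ai bj).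
Qed.

Theorem proposition3p17 (R : realType) (k : scalar_kind) (p : R) (p1 : 1 <= p)
    (J : index_kind) :
  exists (V : countType) (edge : rel V) (root : V) (lambda : V -> scalar_field R k)
         (T : {linear l1 V (scalar_field R k) -> l1 V (scalar_field R k)})
         (cT : continuous T),
    [/\ rooted_tree edge root,
        (forall v, lambda v != 0),
        weighted_shift edge lambda T,
        frequently_hypercyclic (BT p1 J T cT) &
        ~ chaotic (BT p1 J T cT)].
Proof.
case: k.
  have [q qd] := real_dense_sequence R.
  apply: (@fhc_not_chaotic_shift R R^o q qd (fun a b : R => a * b) 1) => [c x|].
    by rewrite -[_ *: _]/(c * 1) mulr1.
  exact: oner_neq0.
have [q qd] := complex_dense_sequence R.
apply: (@fhc_not_chaotic_shift R (Rcomplex R) q qd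
  (fun a b : R[i] => a * b) 1) => [c [x y]|].
  rewrite -[c *: 1]/(complex.Complex (c * 1) (c * 0)) mulr1 mulr0.
  by rewrite /GRing.mul/= !mul0r subr0 addr0.
by rewrite oner_neq0.
Qed.
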